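(* Let $N, h$ be positive integers with $1 \leq h \leq 2N^2$, and let $\varepsilon>0$. Then \[ T(h,N) = \Big( \frac{8}{\zeta(2)} - 4 \Big)N^2 \Big( \sum_{d \mid h} \frac{1}{d} \Big) + O_{\varepsilon}\big(N^{\varepsilon}(N + |h-N^2|)\big), \] where the implied constant depends only on $\varepsilon$.
   Context: For positive integers $h,N$, $T(h,N)$ denotes the number of $(a,b,c,d)\in\mathbb{Z}^4$ with $ad-bc=h$ and $|a|,|b|,|c|,|d|\leq N$. $\zeta$ is the Riemann zeta function. The notation $Y=O_\varepsilon(X)$ means $|Y|\leq C_\varepsilon X$ for a constant $C_\varepsilon>0$ depending only on $\varepsilon$. *)

(* Defs.v *)
From mathcomp Require Import all_boot all_order all_algebra.
From mathcomp Require Import finmap.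
From mathcomp Require Import all_classical all_reals all_analysis.

Set Implicit Arguments.
Unset Strict Implicit.
Unset Printing Implicit Defensive.

Import Order.TTheory GRing.Theory Num.Theory.
Import numFieldNormedType.Exports.
Local Open Scope classical_set_scope.
Local Open Scope ring_scope.

(* The Riemann zeta function on the real half-line 1 < s, as the Dirichlet
   series 1 + 2^-s + 3^-s + ...; no meaning is intended for s <= 1. *)
Definition zeta (R : realType) (s : R) : R := limn (series (riemannR s)).

Definition det_box (h N : nat) : set (int * int * int * int) :=
  [set q | let: (a, b, c, d) := q in
    a * d - b * c = h%:Z /\
    [/\ `|a| <= N%:Z, `|b| <= N%:Z, `|c| <= N%:Z & `|d| <= N%:Z]].

(* fset_set is the empty set on infinite sets, so finiteness is what makes T
   below the actual cardinality. *)
Lemma finite_det_box (h N : nat) : finite_set (det_box h N).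
Proof.
pose I : set int := [set x : int | `|x| <= N%:Z].
have finI : finite_set I.
  apply: (@sub_finite_set _ _ ((fun k : nat => k%:Z - N%:Z) @` `I_(N + N).+1)).
    move=> x /=; rewrite /I /= ler_norml => /andP[lNx lxN].
    exists (absz (x + N%:Z)) => /=; last first.
      by rewrite gez0_abs ?addrK // -(opprK N%:Z) subr_ge0.
    rewrite ltnS -lez_nat gez0_abs; first by rewrite PoszD lerD2r.
    by rewrite -(opprK N%:Z) subr_ge0.
  exact/finite_image/finite_II.
apply: (@sub_finite_set _ _ (I `*` I `*` I `*` I)).
  by move=> [[[a b] c] d] /= [_ [? ? ? ?]].
by do 3!apply: finite_setX => //.
Qed.

Definition T (h N : nat) : nat := #|` fset_set (det_box h N)|.

(* Main.v *)
(** Sublattices of Z^2 of index h are counted by the sum of the divisors of h,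
    i.e. by h * sum_(d | h) 1/d.  Take a box |x| <= X, |y| <= Y with
    X * Y < h < (X + 1) * (Y + 1).  By pigeonhole every such lattice has a
    nonzero vector in the box.  Two lattice vectors of the box in the same
    quadrant have determinant less than h in absolute value, hence are parallel;
    two in adjacent quadrants have determinant strictly between 0 and 2h, hence
    equal to h, and form a basis.  So a lattice meets one quadrant or both, and
      #{ad + bc = h in the box} + #lattices
        = #{lattices meeting Q1} + #{lattices meeting Q4}.
    A vector (x, y) lies in sum_(d | gcd(h, x, y)) d lattices, and Möbius
    inversion along rays turns this into X Y / zeta(2) * sum_(d | h) 1/d for
    each of the last two terms.  Finally X = N, Y = (h - 1) %/ N; the solutions
    of ad - bc = h outside the four corresponding sign classes, or affected by
    replacing Y by N, are few by the divisor bound. *)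
Require Import Defs.
From mathcomp Require Import all_boot all_order all_algebra.
From mathcomp Require Import finmap.
From mathcomp Require Import all_classical all_reals all_analysis.
From mathcomp Require Import zify ring lra.

Set Implicit Arguments.
Unset Strict Implicit.
Unset Printing Implicit Defensive.

Import Order.TTheory GRing.Theory Num.Theory.
Import numFieldNormedType.Exports.
Local Open Scope ring_scope.

(** * The Möbius function *)

Lemma sum_multiples (V : nmodType) (F : nat -> V) (p K : nat) : (0 < p)%N ->
  \sum_(1 <= k < K.+1 | (p %| k)%N) F k = \sum_(1 <= l < (K %/ p).+1) F (p * l)%N.
Proof.
move=> p0; elim: K => [|K IH]; first by rewrite div0n !big_geq.
rewrite big_mkcond big_nat_recr //= -big_mkcond IH /=.
case: ifPn => [dvd|ndvd].
  have -> : (K.+1 %/ p = (K %/ p).+1)%N by nia.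
  rewrite [RHS]big_nat_recr //=; congr (_ + F _).
  have : (K.+1 = K.+1 %/ p * p)%N by rewrite divnK.
  have -> : (K.+1 %/ p = (K %/ p).+1)%N by nia.
  by rewrite mulnC.
by rewrite addr0; have -> // : (K.+1 %/ p = K %/ p)%N by nia.
Qed.

(** A squared prime factor makes the product 0. At n = 0 the list of primes is empty and the value
    is 1; the sums below start at k = 1. *)
Definition mobius (R : pzRingType) (n : nat) : R :=
  \prod_(p <- primes n) (if logn p n == 1%N then -1 else 0).

Lemma mobius1 (R : pzRingType) : mobius R 1 = 1.
Proof. by rewrite /mobius big_nil. Qed.

Lemma norm_mobius_le1 (R : numDomainType) n : `|mobius R n| <= 1.
Proof.
rewrite /mobius; elim/big_ind: _ => [|x y x1 y1|p _].
- by rewrite normr1.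
- by rewrite normrM mulr_ile1.
- by case: ifP => _; rewrite ?normrN ?normr1 ?normr0.
Qed.

Lemma mobius_primeM (R : comPzRingType) (p l : nat) : prime p -> (0 < l)%N ->
  mobius R (p * l) = if (p %| l)%N then 0 else - mobius R l.
Proof.
move=> pp l0; have p0 := prime_gt0 pp.
case: ifPn => [pl|npl].
  have pin : p \in primes (p * l) by rewrite mem_primes pp muln_gt0 p0 l0 dvdn_mulr.
  rewrite /mobius (big_rem p) //= lognM // (pfactorK 1) // ifF ?mul0r //.
  apply/negbTE; have : (0 < logn p l)%N by rewrite logn_gt0 mem_primes pp l0.
  by move=> ?; lia.
have perm : perm_eq (primes (p * l)) (p :: primes l).
  apply: uniq_perm; rewrite ?primes_uniq //=.
    by rewrite primes_uniq mem_primes (negbTE npl) !andbF.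
  by move=> q; rewrite primesM // inE primes_prime // mem_seq1.
rewrite /mobius (perm_big _ perm) big_cons /= lognM // (pfactorK 1) //.
have -> : logn p l = 0%N by rewrite lognE pp l0 (negbTE npl).
rewrite mulN1r; congr (- _); rewrite big_seq [RHS]big_seq; apply: eq_bigr => q ql.
rewrite lognM // (logn_prime q pp); case: (eqVneq q p) => [eqp|//]; exfalso.
by move: ql npl; rewrite mem_primes eqp => /and3P[_ _ ->].
Qed.

(** With p a prime factor of n, a divisor k = p l contributes 0 when p | l and [- mobius R l]
    otherwise, which cancels the divisors prime to p. The free bound K lets divisor sums for
    different n share one range. *)
Lemma sum_mobius (R : comPzRingType) (K n : nat) : (0 < n <= K)%N ->
  \sum_(1 <= k < K.+1 | (k %| n)%N) mobius R k = (n == 1%N)%:R.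
Proof.
move=> /andP[n0 nK].
have [->|n1] := eqVneq n 1%N.
  rewrite (eq_bigl (pred1 1%N)); last by move=> k; rewrite dvdn1.
  by rewrite big_nat1_eq ifT ?mobius1 //; lia.
pose p := pdiv n; have pp : prime p by apply: pdiv_prime; lia.
have p0 := prime_gt0 pp.
have pn : (p %| n)%N := pdiv_dvd n.
rewrite (bigID (fun k => (p %| k)%N)) /=.
under eq_bigl => k do rewrite andbC.
rewrite big_mkcondr sum_multiples //=.
transitivity (\sum_(1 <= l < (K %/ p).+1 | (l %| n)%N && ~~ (p %| l)%N) - mobius R l
   + \sum_(1 <= k < K.+1 | (k %| n)%N && ~~ (p %| k)%N) mobius R k).
  congr (_ + _); rewrite [RHS]big_mkcond; apply: eq_big_nat => l /andP[l0 _].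
  rewrite mobius_primeM //; case: (boolP (p %| l)%N) => pl; first by rewrite andbF if_same.
  rewrite andbT Gauss_dvd ?pn // prime_coprime //.
(* Here l = k / p only runs up to K %/ p; a divisor l of n prime to p beyond that would give p l | n
   with p l > K >= n. *)
rewrite [X in _ + X](big_cat_nat (n := (K %/ p).+1)) //=; last by rewrite ltnS leq_div.
rewrite sumrN addrA addNr add0r big_nat_cond big1 // => l /andP[/andP[l1 l2] /andP[ln pl]].
have : (p * l %| n)%N by rewrite Gauss_dvd ?pn // prime_coprime.
move=> /(dvdn_leq n0) pln; have : (p * l <= K)%N by lia.
by rewrite mulnC -leq_divRL // leqNgt l1.
Qed.

(** * Partial sums of zeta(2) and the harmonic series *)

Definition harm (R : realType) (K : nat) : R := \sum_(1 <= k < K.+1) k%:R^-1.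

Lemma harm_ge1 (R : realType) K : (0 < K)%N -> 1 <= harm R K.
Proof.
move=> K0; rewrite /harm big_ltn ?ltnS // invr1 lerDl.
by apply: sumr_ge0 => i _; rewrite invr_ge0 ler0n.
Qed.

(** Induction: the new term 1/(K+1) is absorbed by ln (K/(K+1)) <= -1/(K+1). *)
Lemma harm_le_ln (R : realType) K : (0 < K)%N -> harm R K <= 1 + ln (K%:R : R).
Proof.
rewrite /harm; elim: K => [//|[_ _|K IH _]].
  by rewrite big_nat1 ln1 invr1 addr0.
rewrite big_nat_recr //=; have := IH isT.
have lt0 : (0 : R) < K.+1%:R by rewrite ltr0n.
have lt1 : (0 : R) < K.+2%:R by rewrite ltr0n.
have eqK : (K.+1%:R : R) / K.+2%:R = 1 + - K.+2%:R^-1.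
  have -> : K.+1%:R = K.+2%:R - 1 :> R by rewrite -[K.+2%:R]natr1 addrK.
  by rewrite mulrBl mul1r divff // gt_eqF.
have : ln ((K.+1%:R : R) / K.+2%:R) <= - K.+2%:R^-1.
  rewrite eqK; apply: le_ln1Dx; rewrite ltrN2 invf_lt1 //.
  by rewrite ltr1n.
rewrite lnM ?posrE ?invr_gt0 // lnV ?posrE //.
set u := _^-1; set s := \sum_(_ <= _ < _) _; set l1 := ln _; set l2 := ln _ => *; lra.
Qed.

(** The inequality ln y <= y - 1 at y = x^d. *)
Lemma ln_le_powR (R : realType) (d x : R) : 0 < d -> 0 < x -> ln x <= x `^ d / d.
Proof.
move=> d0 x0; rewrite ler_pdivlMr // mulrC -ln_powR.
have p0 : 0 < x `^ d by apply: powR_gt0.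
have := @le_ln1Dx R (x `^ d - 1); rewrite [1 + _]addrC subrK; lra.
Qed.

Lemma harm_le_powR (R : realType) (d : R) K : 0 < d -> (0 < K)%N ->
  harm R K <= (1 + d^-1) * K%:R `^ d.
Proof.
move=> d0 K0; apply: (le_trans (harm_le_ln R K0)).
rewrite mulrDl mul1r lerD //.
  by rewrite -[leLHS](powRr0 K%:R) ler_powR ?ler1n // ltW.
by rewrite mulrC ln_le_powR // ltr0n.
Qed.

Lemma series_riemannR2E (R : realType) n :
  series (riemannR (2 : R)) n = \sum_(1 <= l < n.+1) (l%:R ^+ 2)^-1.
Proof.
rewrite big_add1 /=; apply: eq_bigr => k _.
by rewrite /riemannR powR_mulrn // ler0n.
Qed.

(** Telescoping with 1/(x+1)^2 <= 1/x - 1/(x+1); letting m grow bounds zeta(2) by the n-th partial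
    sum plus 1/n. *)
Lemma series_riemannR2_tail (R : realType) n m : (0 < n)%N ->
  series (riemannR (2 : R)) (n + m)%N + (n + m)%:R^-1 <=
  series (riemannR (2 : R)) n + n%:R^-1.
Proof.
move=> n0; elim: m => [|m IH]; first by rewrite addn0.
apply: le_trans IH; rewrite addnS seriesSr /riemannR.
rewrite powR_mulrn ?ler0n // -addrA lerD2l.
have x0 : (0 : R) < (n + m)%:R by rewrite ltr0n; lia.
rewrite -natr1; move: (_%:R : R) x0 => x x0.
rewrite -subr_ge0.
have -> : x^-1 - (((x + 1) ^+ 2)^-1 + (x + 1)^-1) = (x * (x + 1) ^+ 2)^-1.
  by field; rewrite !gt_eqF //; lra.
by rewrite invr_ge0 mulr_ge0 ?exprn_ge0 //; lra.
Qed.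

Lemma series_riemannR2_nd (R : realType) :
  {homo series (riemannR (2 : R)) : n m / (n <= m)%N >-> n <= m}.
Proof.
by apply: nondecreasing_series => n _ _ /=; rewrite invr_ge0 powR_ge0.
Qed.

Lemma cvg_series_riemannR2 (R : realType) : cvgn (series (riemannR (2 : R))).
Proof.
apply: nondecreasing_is_cvgn; first exact: series_riemannR2_nd.
exists (series (riemannR (2 : R)) 1 + 1) => _ [n _ <-].
have := @series_riemannR2_tail R 1 n isT; rewrite invr1.
have := @series_riemannR2_nd R n (1 + n)%N (leq_addl _ _).
have : (0 : R) <= (1 + n)%:R^-1 by rewrite invr_ge0 ler0n.
lra.
Qed.

Lemma series_riemannR2_le_zeta (R : realType) n :
  series (riemannR (2 : R)) n <= zeta (2 : R).
Proof.
apply: nondecreasing_cvgn_le; [exact: series_riemannR2_nd|exact: cvg_series_riemannR2].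
Qed.

Lemma zeta_le_series_riemannR2 (R : realType) n : (0 < n)%N ->
  zeta (2 : R) <= series (riemannR (2 : R)) n + n%:R^-1.
Proof.
move=> n0; apply: limr_le; first exact: cvg_series_riemannR2.
near=> m; have nm : (n <= m)%N by near: m; exact: nbhs_infty_ge.
have := @series_riemannR2_tail R n (m - n) n0; rewrite subnKC //.
have : (0 : R) <= m%:R^-1 by rewrite invr_ge0 ler0n.
lra.
Unshelve. all: by end_near.
Qed.

Lemma zeta2_ge1 (R : realType) : 1 <= zeta (2 : R).
Proof.
apply: le_trans (series_riemannR2_le_zeta R 1).
by rewrite series_riemannR2E big_nat1 expr1n invr1.
Qed.

(** A finite exact form of zeta(2) times the sum of mu(k)/k^2 being 1: expanding over products n = k
    l <= K leaves only n = 1. *)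
Lemma mobius_zeta2_truncated (R : realType) K : (0 < K)%N ->
  \sum_(1 <= k < K.+1) mobius R k / k%:R ^+ 2 * series (riemannR (2 : R)) (K %/ k)%N = 1.
Proof.
move=> K0.
transitivity (\sum_(1 <= k < K.+1) \sum_(1 <= n < K.+1)
    if (k %| n)%N then mobius R k / n%:R ^+ 2 else 0).
  apply: eq_big_nat => k /andP[k0 _].
  rewrite -big_mkcond sum_multiples // series_riemannR2E mulr_sumr.
  by apply: eq_bigr => l _; rewrite natrM exprMn -mulrA -invfM.
rewrite exchange_big_nat /=.
transitivity (\sum_(1 <= n < K.+1) (n == 1%N)%:R / n%:R ^+ 2 : R).
  apply: eq_big_nat => n /andP[n0 nK].
  by rewrite -big_mkcond -mulr_suml sum_mobius // n0.
rewrite big_ltn // eqxx expr1n invr1 mulr1 big_nat big1 ?addr0 // => n /andP[n1 _].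
by rewrite gtn_eqF // mul0r.
Qed.

Definition mobius_sum (R : realType) (K : nat) : R :=
  \sum_(1 <= k < K.+1) mobius R k / k%:R ^+ 2.

(** After multiplication by zeta(2) >= 1, the exact truncated identity is subtracted termwise. The
    k-th difference is at most 1/k^2 times the tail of zeta(2) beyond K %/ k, hence at most 2/(k
    K). *)
Lemma mobius_sum_approx (R : realType) K : (0 < K)%N ->
  `|mobius_sum R K - (zeta (2 : R))^-1| <= 2 * harm R K / K%:R.
Proof.
move=> K0; have z1 := zeta2_ge1 R; set z := zeta _ in z1 *.
have z0 : 0 < z by lra.
suff H : `|z * mobius_sum R K - 1| <= 2 * harm R K / K%:R.
  have -> : mobius_sum R K - z^-1 = (z * mobius_sum R K - 1) / z.
    by field; rewrite gt_eqF.
  rewrite normrM (gtr0_norm (_ : 0 < z^-1)) ?invr_gt0 //.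
  rewrite ler_pdivrMr //; apply: (le_trans H); rewrite ler_peMr //.
  exact: le_trans H.
rewrite -[X in _ - X](mobius_zeta2_truncated R K0) /mobius_sum mulr_sumr -sumrB.
rewrite /harm mulr_sumr mulr_suml; apply: (le_trans (ler_norm_sum _ _ _)).
rewrite big_nat [leRHS]big_nat; apply: ler_sum => k /andP[k0 kK].
rewrite mulrC -mulrBr !normrM.
have q0 : (0 < K %/ k)%N by rewrite divn_gt0.
have := series_riemannR2_le_zeta R (K %/ k)%N; have := zeta_le_series_riemannR2 R q0.
rewrite -/z; set s := series _ _ => zs sz.
rewrite (@ger0_norm _ (z - s)) ?subr_ge0 //.
have kp : (0 : R) < k%:R by rewrite ltr0n.
have Kp : (0 : R) < K%:R by rewrite ltr0n.
rewrite (@ger0_norm _ (_ ^-1)) ?invr_ge0 ?exprn_ge0 ?ler0n //.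
apply: (@le_trans _ _ ((k%:R ^+ 2)^-1 * (K %/ k)%:R^-1)).
  apply: ler_pM; rewrite ?mulr_ge0 ?invr_ge0 ?exprn_ge0 ?ler0n ?subr_ge0 //.
    by rewrite ler_piMl ?norm_mobius_le1 // invr_ge0 exprn_ge0 // ltW.
  lra.
have -> : 2 * k%:R^-1 / K%:R = (k%:R ^+ 2)^-1 * (2 * k%:R / K%:R) :> R.
  by field; rewrite !gt_eqF.
rewrite ler_pM2l ?invr_gt0 ?exprn_gt0 //.
(* For k <= K the floor K %/ k is at least K/(2k). *)
rewrite -[leLHS]mul1r ler_pdivrMr ?ltr0n // mulrAC ler_pdivlMr // mul1r.
rewrite -!natrM ler_nat; nia.
Qed.

(** * The divisor bound *)

(** Every divisor of p^e m has the form p^i d with i <= e and d | m. *)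
Lemma size_divisors_primeXM (p e m : nat) : prime p -> (0 < m)%N ->
  (size (divisors (p ^ e * m)) <= e.+1 * size (divisors m))%N.
Proof.
move=> pp m0; have p0 : (0 < p ^ e)%N by rewrite expn_gt0 prime_gt0.
have n0 : (0 < p ^ e * m)%N by rewrite muln_gt0 p0.
have -> : (e.+1 * size (divisors m) =
    size [seq (p ^ i * d)%N | i <- iota 0 e.+1, d <- divisors m])%N.
  by rewrite size_allpairs size_iota.
apply: uniq_leq_size; first exact: divisors_uniq.
move=> x; rewrite -dvdn_divisors // => xn.
have x0 : (0 < x)%N := dvdn_gt0 n0 xn.
have [i ie gE] : exists2 i, (i <= e)%N & gcdn x (p ^ e) = (p ^ i)%N.
  by apply/dvdn_pfactor => //; exact: dvdn_gcdr.
have g0 : (0 < gcdn x (p ^ e))%N by rewrite gcdn_gt0 x0.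
apply/allpairsP; exists (i, x %/ p ^ i)%N; split.
- by rewrite mem_iota add0n ltnS ie.
- rewrite /= -dvdn_divisors // -gE.
  have xE := divnK (dvdn_gcdl x (p ^ e)); have pE := divnK (dvdn_gcdr x (p ^ e)).
  set g := gcdn _ _ in g0 xE pE *.
  (* Dividing by g = gcd(x, p^e) leaves x/g coprime to p^e/g, so x/g must divide m. *)
  have cop : coprime (x %/ g) (p ^ e %/ g).
    by rewrite /coprime -(eqn_pmul2r g0) mul1n muln_gcdl xE pE.
  rewrite -(Gauss_dvdr _ cop) -(dvdn_pmul2r g0) xE mulnAC pE //.
- by rewrite mulnC divnK // -gE dvdn_gcdl.
Qed.

(** Bernoulli's inequality x^e >= 1 + e (x - 1), multiplied by 1 + 1/(x - 1). *)
Lemma succn_le_expr (R : realType) (x : R) (e : nat) : 1 < x ->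
  e.+1%:R <= (1 + (x - 1)^-1) * x ^+ e.
Proof.
move=> x1; have d0 : 0 < x - 1 by lra.
have -> : x ^+ e = (1 + (x - 1)) ^+ e by rewrite addrC subrK.
move: (x - 1) d0 => d d0; have dV : 0 < d^-1 by rewrite invr_gt0.
have B : 1 + e%:R * d <= (1 + d) ^+ e.
  elim: e => [|e IH]; first by rewrite expr0 mul0r addr0.
  rewrite exprS -natr1.
  have e0 : (0 : R) <= e%:R by rewrite ler0n.
  apply: (@le_trans _ _ ((1 + d) * (1 + e%:R * d))).
    rewrite -subr_ge0; have -> : (1 + d) * (1 + e%:R * d) - (1 + (e%:R + 1) * d) = e%:R * d ^+ 2 by ring.
    by rewrite mulr_ge0 // exprn_ge0 // ltW.
  by rewrite ler_pM2l //; lra.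
apply: (@le_trans _ _ ((1 + d^-1) * (1 + e%:R * d))); last by rewrite ler_pM2l //; lra.
have -> : (1 + d^-1) * (1 + e%:R * d) = 1 + e%:R * d + d^-1 + e%:R.
  by field; rewrite gt_eqF.
have : 0 <= e%:R * d by rewrite mulr_ge0 ?ler0n // ltW.
rewrite -natr1; lra.
Qed.

(** Prime powers are treated one at a time: e + 1 <= 2^e <= p^(d e) once p >= P >= 2^(1/d), and each
    smaller prime costs a constant factor A, whence C = A^P. *)
Lemma size_divisors_le_powR (R : realType) (d : R) : 0 < d ->
  exists2 C : R, 1 <= C & forall n, (0 < n)%N ->
    (size (divisors n))%:R <= C * n%:R `^ d.
Proof.
move=> d0.
pose P := Num.bound (2 `^ d^-1 : R).
have P2 : forall p, (P <= p)%N -> 2 <= p%:R `^ d :> R.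
  move=> p Pp; have -> : 2 = (2 `^ d^-1) `^ d :> R.
    by rewrite -powRrM mulVf ?gt_eqF // powRr1.
  apply: ge0_ler_powR; rewrite ?nnegrE ?powR_ge0 ?ler0n //; first exact: ltW.
  apply: (@le_trans _ _ P%:R); last by rewrite ler_nat.
  by apply/ltW/archi_boundP/powR_ge0.
pose A : R := 1 + (2 `^ d - 1)^-1.
have x1 : 1 < 2 `^ d :> R.
  by rewrite -[ltLHS](congr1 (@^~ d) (powR1 R)) gt0_ltr_powR ?nnegrE //; lra.
have A1 : 1 <= A by rewrite lerDl invr_ge0; lra.
have step p e : prime p -> e.+1%:R <= (if (p < P)%N then A else 1) * (p ^ e)%:R `^ d :> R.
  move=> pp; have -> : (p ^ e)%:R `^ d = (p%:R `^ d) ^+ e :> R.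
    by rewrite natrX -powR_mulrn ?ler0n // powRAC powR_mulrn // powR_ge0.
  case: ltnP => pP.
    apply: (le_trans (succn_le_expr e x1)); rewrite ler_pM2l; last exact: lt_le_trans ltr01 A1.
    apply: lerXn2r; rewrite ?nnegrE ?powR_ge0 //.
    apply: ge0_ler_powR; rewrite ?nnegrE ?ler0n //; first exact: ltW.
    by rewrite ler_nat prime_gt1.
  rewrite mul1r; have lt12 : (1 : R) < 2 by lra.
  apply: (@le_trans _ _ (2 ^+ e)); last by rewrite lerXn2r ?nnegrE ?powR_ge0 // P2.
  by rewrite -natrX ler_nat ltn_expl.
have main (e : nat -> nat) (ps : seq nat) : all prime ps ->
    (size (divisors (\prod_(p <- ps) p ^ e p)))%:R <=
    A ^+ (count (fun p => p < P)%N ps) * (\prod_(p <- ps) p ^ e p)%N%:R `^ d.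
  elim: ps => [_|p ps IH /= /andP[pp aps]].
    by rewrite !big_nil /= powR1 mulr1.
  rewrite !big_cons; set m := (\prod_(_ <- ps) _)%N in IH *.
  have m0 : (0 < m)%N.
    rewrite /m big_seq prodn_cond_gt0 // => q /(allP aps) qp.
    by rewrite expn_gt0 prime_gt0.
  apply: (@le_trans _ _ ((e p).+1 * size (divisors m))%N%:R).
    by rewrite ler_nat size_divisors_primeXM.
  rewrite natrM [X in _ <= _ * X `^ _]natrM powRM ?ler0n // exprD mulrACA.
  apply: ler_pM; rewrite ?ler0n //; last exact: IH.
  by have := step p (e p) pp; case: ifP => _; rewrite ?expr1 ?expr0.
exists (A ^+ P); first exact: exprn_ege1.
move=> n n0; have ap : all prime (primes n).
  by apply/allP => p; rewrite mem_primes => /and3P[].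
have := main (logn^~ n) (primes n) ap.
rewrite -(big_map (fun p => (p, logn p n)) xpredT (fun f => f.1 ^ f.2)%N).
rewrite -prime_decompE -prod_prime_decomp // => H; apply: (le_trans H).
rewrite ler_wpM2r ?powR_ge0 // ler_weXn2l //.
(* The exponent of A counts distinct primes below P, so it is at most P. *)
rewrite -size_filter -[leqRHS](size_iota 0); apply: uniq_leq_size.
  by rewrite filter_uniq // primes_uniq.
by move=> p; rewrite mem_filter mem_iota add0n => /andP[].
Qed.

(** * Linear congruences and complementary divisors *)

Lemma sum_modn_eq (e r g : nat) : (r < e)%N ->
  (\sum_(0 <= j < g * e) (j %% e == r)%N)%N = g.
Proof.
move=> re; elim: g => [|g IH]; first by rewrite mul0n big_geq.
rewrite mulSn addnC (big_cat_nat (n := (g * e)%N)) ?leq_addr //= IH -addn1; congr addn.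
rewrite -[X in index_iota X](add0n (g * e)%N) big_addn addKn.
transitivity (\sum_(0 <= i < e | i == r) 1)%N; last by rewrite big_nat1_eq /= re.
rewrite [RHS]big_mkcond; apply: eq_big_nat => i /andP[_ ie].
by rewrite addnC modnMDl modn_small //; case: eqP.
Qed.

Lemma perm_divisors_div n : (0 < n)%N ->
  perm_eq [seq (n %/ d)%N | d <- divisors n] (divisors n).
Proof.
move=> n0; have inv d : (d %| n)%N -> (n %/ (n %/ d) = d)%N by move=> dn; rewrite divnA // mulKn.
have uq : uniq [seq (n %/ d)%N | d <- divisors n].
  rewrite map_inj_in_uniq ?divisors_uniq // => d1 d2.
  rewrite -!dvdn_divisors // => d1n d2n E.
  by rewrite -(inv _ d1n) E inv.
apply: uniq_perm; rewrite ?divisors_uniq // => d.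
apply/mapP/idP => [[k]|dn].
  by rewrite -!dvdn_divisors // => kn ->; rewrite dvdn_div.
exists (n %/ d)%N; first by move: dn; rewrite -!dvdn_divisors // => /dvdn_div.
by rewrite inv // dvdn_divisors.
Qed.

(** The congruence j t = x mod e is solvable in j only if g = gcd(e, t) divides x. After division by
    g, a Bézout inverse v of t/g turns it into the single class of v x/g modulo e/g, which has g
    representatives below e. *)
Lemma sum_dvdz_affine (e : nat) (t x : int) : (0 < e)%N ->
  (\sum_(0 <= j < e) (e%:Z %| (x - j%:Z * t)%R)%Z)%N =
  if (gcdn e `|t| %| `|x|)%N then gcdn e `|t| else 0%N.
Proof.
move=> e0; set g := gcdn e _; have g0 : (0 < g)%N by rewrite gcdn_gt0 e0.
have ge : (g %| e)%N := dvdn_gcdl _ _.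
have gt : (g%:Z %| t)%Z by rewrite dvdzE dvdn_gcdr.
rewrite -[(g %| _)%N]/(g%:Z %| x)%Z.
case: ifPn => gx; last first.
  apply: big1_seq => j _; apply/eqP; rewrite eqb0; apply: contra gx => ex.
  have -> : x = (x - j%:Z * t) + j%:Z * t by ring.
  rewrite rpredD ?dvdz_mull //; apply: dvdz_trans ex.
  by rewrite dvdzE.
have [e' eE] := dvdnP ge; have [t' tE] := dvdzP gt; have [x' xE] := dvdzP gx.
have e'0 : (0 < e')%N by move: e0; rewrite eE muln_gt0 => /andP[].
have cop : coprimez e'%:Z t'.
  rewrite /coprimez /gcdz /=; apply/eqP; congr Posz.
  apply/eqP; rewrite -(eqn_pmul2r g0) mul1n muln_gcdl -eE.
  by have -> : (`|t'| * g = `|t|)%N by rewrite tE abszM.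
have /coprimezP[[u v] /= uv] := cop.
pose r := absz ((v * x') %% e'%:Z)%Z.
have e'n0 : e'%:Z != 0 by rewrite -lt0n in e'0 *; lia.
have r_ge0 : 0 <= ((v * x') %% e'%:Z)%Z by rewrite modz_ge0.
have re : (r < e')%N by rewrite -ltz_nat /r gez0_abs // ltz_pmod.
rewrite [in index_iota _ _]eE mulnC -[RHS](sum_modn_eq g re).
apply: eq_bigr => j _; congr (nat_of_bool _).
have -> : (e%:Z %| x - j%:Z * t)%Z = (e'%:Z %| x' - j%:Z * t')%Z.
  rewrite eE PoszM xE tE mulrA -mulrBl dvdz_mul2r //; lia.
have -> : (e'%:Z %| x' - j%:Z * t')%Z = (e'%:Z %| v * x' - j%:Z)%Z.
  apply/idP/idP => H.
    have -> : v * x' - j%:Z = v * (x' - j%:Z * t') - (j%:Z * u) * e'%:Z.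
      transitivity (v * x' - j%:Z * (u * e'%:Z + v * t')); last by ring.
      by rewrite uv mulr1.
    by rewrite rpredB ?dvdz_mull.
  have -> : x' - j%:Z * t' = t' * (v * x' - j%:Z) + (x' * u) * e'%:Z.
    transitivity ((u * e'%:Z + v * t') * x' - j%:Z * t'); last by ring.
    by rewrite uv mul1r.
  by rewrite rpredD ?dvdz_mull.
rewrite -eqz_mod_dvd eq_sym; apply/eqP/eqP => H; last first.
  by rewrite -[RHS]gez0_abs // -/r -H modz_nat.
by apply/eqP; rewrite -eqz_nat -modz_nat H /r gez0_abs.
Qed.

(** * Sublattices of Z^2 *)

(* The sublattice of Z^2 of index h spanned by (h/f, 0) and (j, f); letting
   f run over the divisors of h and j over [0, h/f), Hermite normal form shows
   that every sublattice of index h occurs exactly once. *)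
Definition inlat (h f j : nat) (x y : int) : bool :=
  (f%:Z %| y)%Z && ((h %/ f)%N%:Z %| x - j%:Z * (y %/ f%:Z)%Z)%Z.

Lemma inlatP h f j x y : (0 < f)%N ->
  reflect (exists s t : int, x = s * (h %/ f)%N%:Z + t * j%:Z /\ y = t * f%:Z)
          (inlat h f j x y).
Proof.
move=> f0; have fn0 : f%:Z != 0 by lia.
apply: (iffP andP) => [[/dvdzP[t ->]]|[s [t [-> ->]]]].
  rewrite mulzK // => /dvdzP[s sE]; exists s, t; split => //.
  by rewrite -sE; ring.
rewrite mulzK // dvdz_mull //; split => //.
by apply/dvdzP; exists s; ring.
Qed.

Lemma inlatB h f j x y x' y' : (0 < f)%N ->
  inlat h f j x y -> inlat h f j x' y' -> inlat h f j (x - x') (y - y').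
Proof.
move=> f0 /(inlatP _ _ _ _ f0)[s [t [-> ->]]] /(inlatP _ _ _ _ f0)[s' [t' [-> ->]]].
by apply/inlatP => //; exists (s - s'), (t - t'); split; ring.
Qed.

Lemma inlatZ h f j (k x y : int) : (0 < f)%N ->
  inlat h f j x y -> inlat h f j (k * x) (k * y).
Proof.
move=> f0 /(inlatP _ _ _ _ f0)[s [t [-> ->]]].
by apply/inlatP => //; exists (k * s), (k * t); split; ring.
Qed.

(** The determinant is (h/f) f = h times the determinant of the coordinates (s, t), (s', t'). *)
Lemma inlat_det h f j x y x' y' : (0 < f)%N -> (f %| h)%N ->
  inlat h f j x y -> inlat h f j x' y' -> (h%:Z %| x * y' - x' * y)%Z.
Proof.
move=> f0 fh /(inlatP _ _ _ _ f0)[s [t [-> ->]]] /(inlatP _ _ _ _ f0)[s' [t' [-> ->]]].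
have -> : h%:Z = (h %/ f)%N%:Z * f%:Z by rewrite -PoszM divnK.
by apply/dvdzP; exists (s * t' - s' * t); ring.
Qed.

(** The lattice has h cosets and the box of points (x, y) with 0 <= x <= X, 0 <= y <= Y has more
    than h points; two points of one coset differ by the required vector. *)
Lemma inlat_pigeonhole h f j X Y : (0 < h)%N -> (f %| h)%N ->
  (h < X.+1 * Y.+1)%N ->
  exists x y : int, [/\ inlat h f j x y, `|x| <= X%:Z, `|y| <= Y%:Z
                      & (x != 0) || (y != 0)].
Proof.
move=> h0 fh hXY; have f0 := dvdn_gt0 h0 fh.
have e0 : (0 < h %/ f)%N by rewrite divn_gt0 // dvdn_leq.
set e := (h %/ f)%N in e0.
have hE : (e * f = h)%N by rewrite divnK.
(* F reads off the coset of a point. The factor [e.-1] acts as -1 modulo e, which keeps the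
   computation in nat. *)
pose F (p : 'I_X.+1 * 'I_Y.+1) : 'I_f * 'I_e :=
  (Ordinal (ltn_pmod p.2 f0),
   Ordinal (ltn_pmod (p.1 + e.-1 * j * (p.2 %/ f))%N e0)).
have /injectivePn[[x1 y1] [[x2 y2] neq [/eqP Ey /eqP Ex]]] : ~~ injectiveb F.
  apply/injectiveP => /leq_card; rewrite !card_prod !card_ord; lia.
rewrite /= in Ey Ex.
exists (x1%:Z - x2%:Z), (y1%:Z - y2%:Z); split.
- have yE : y1%:Z - y2%:Z = ((y1 %/ f)%N%:Z - (y2 %/ f)%N%:Z) * f%:Z.
    by rewrite {1}(divn_eq y1 f) {1}(divn_eq y2 f) (eqP Ey); lia.
  rewrite /inlat yE dvdz_mull //= mulzK; last by lia.
  rewrite -/e; move: Ex; rewrite -eqz_nat -!modz_nat eqz_mod_dvd.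
  set q1 := (y1 %/ f)%N; set q2 := (y2 %/ f)%N => /dvdzP[k kE].
  have eE : e%:Z = e.-1%:Z + 1 by lia.
  apply/dvdzP; exists (k - j%:Z * (q1%:Z - q2%:Z)).
  rewrite mulrBl -kE eE !PoszD !PoszM; ring.
- by have := ltn_ord x1; have := ltn_ord x2; lia.
- by have := ltn_ord y1; have := ltn_ord y2; lia.
- apply: contraNT neq; rewrite negb_or !negbK !subr_eq0 !eqz_nat.
  by move=> /andP[/eqP/val_inj -> /eqP/val_inj ->].
Qed.

(** With G = gcd(h, y), only the f dividing G contribute, and the congruence for j has gcd(h/f, y/f)
    = G/f solutions if G/f divides x, none otherwise. Then d = G/f runs over the divisors of G. *)
Lemma sum_inlat h (x y : int) : (0 < h)%N ->
  (\sum_(f <- divisors h) \sum_(0 <= j < h %/ f) inlat h f j x y)%N =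
  (\sum_(d <- divisors h | (d %| `|x|) && (d %| `|y|)) d)%N.
Proof.
move=> h0; set G := gcdn h `|y|.
have G0 : (0 < G)%N by rewrite gcdn_gt0 h0.
have divG d : (d \in divisors G) = (d \in divisors h) && (d %| `|y|)%N.
  by rewrite -!dvdn_divisors // dvdn_gcd.
transitivity (\sum_(f <- divisors G) if (G %/ f %| `|x|)%N then (G %/ f)%N else 0)%N.
  transitivity (\sum_(f <- [seq f <- divisors h | (f %| `|y|)%N])
     if (G %/ f %| `|x|)%N then (G %/ f)%N else 0)%N; last first.
    apply: perm_big; apply: uniq_perm; rewrite ?filter_uniq ?divisors_uniq // => d.
    by rewrite mem_filter divG andbC.
  rewrite big_filter [RHS]big_mkcond big_seq [RHS]big_seq; apply: eq_bigr => f.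
  rewrite -dvdn_divisors // => fh; have f0 := dvdn_gt0 h0 fh.
  have e0 : (0 < h %/ f)%N by rewrite divn_gt0 // dvdn_leq.
  case: ifPn => fy; last first.
    by apply: big1_seq => j _; rewrite /inlat dvdzE (negbTE fy).
  transitivity (\sum_(0 <= j < h %/ f) ((h %/ f)%N%:Z %| (x - j%:Z * (y %/ f%:Z)%Z)%R)%Z)%N.
    by apply: eq_bigr => j _; rewrite /inlat dvdzE fy.
  rewrite sum_dvdz_affine //.
  suff -> : gcdn (h %/ f) `|(y %/ f%:Z)%Z| = (G %/ f)%N by [].
  have /dvdzP[q yE] : (f%:Z %| y)%Z by rewrite dvdzE.
  rewrite /G yE mulzK; last by lia.
  apply/eqP; rewrite -(eqn_pmul2r f0) divnK; last first.
    by rewrite dvdn_gcd fh abszM dvdn_mull.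
  by rewrite muln_gcdl divnK // abszM.
rewrite -(big_map (fun f => G %/ f)%N xpredT (fun d => if (d %| `|x|)%N then d else 0%N)).
rewrite (perm_big _ (perm_divisors_div G0)).
rewrite -big_mkcond.
transitivity (\sum_(d <- [seq f <- divisors h | (f %| `|y|)%N] | (d %| `|x|)%N) d)%N.
  apply: perm_big; apply: uniq_perm; rewrite ?filter_uniq ?divisors_uniq // => d.
  by rewrite mem_filter divG andbC.
by rewrite big_filter_cond; apply: eq_bigl => d; rewrite andbC.
Qed.

Lemma sum_eq_seq (T : eqType) (r : seq T) (x : T) : uniq r -> x \in r ->
  (\sum_(y <- r) (y == x) = 1)%N.
Proof.
move=> ur xr; rewrite (bigD1_seq x) //= eqxx big1 // => y /negbTE -> //.
Qed.

Lemma sum_eq_nat (m n i : nat) : (\sum_(m <= k < n) (k == i) = (m <= i < n))%N.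
Proof.
transitivity (\sum_(m <= k < n | k == i) 1)%N; last by rewrite big_nat1_eq; case: ifP.
by rewrite [RHS]big_mkcond; apply: eq_bigr => k _; case: eqP.
Qed.

(** The vectors (a, b) and (c, -d) have determinant -h, so they form a basis of any lattice of index
    h containing them, which determines that lattice. *)
Lemma sum_inlat_pair h (a b c d : nat) : (0 < h)%N -> (a * d + b * c = h)%N ->
  (\sum_(f <- divisors h) \sum_(0 <= j < h %/ f)
     (inlat h f j a b && inlat h f j c (- d%:Z)))%N = 1%N.
Proof.
move=> h0 hE.
have [f0 [j0 [f0h j0e /andP[A0 C0]]]] : exists f0 j0 : nat,
    [/\ (f0 %| h)%N, (j0 < h %/ f0)%N &
        inlat h f0 j0 a b && inlat h f0 j0 c (- d%:Z)].
  pose g := gcdn b d; have g0 : (0 < g)%N by rewrite gcdn_gt0; nia.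
  have [b' bE] := dvdnP (dvdn_gcdl b d); have [d' dE] := dvdnP (dvdn_gcdr b d).
  rewrite -/g in bE dE.
  have eE : (h = (a * d' + b' * c) * g)%N by rewrite -hE {1}dE {1}bE; ring.
  have hg : (h %/ g = a * d' + b' * c)%N by rewrite eE mulnK.
  have e0 : (0 < h %/ g)%N by rewrite hg; nia.
  have cop : coprimez b'%:Z d'%:Z.
    rewrite /coprimez /gcdz /=; apply/eqP; congr Posz; apply/eqP.
    by rewrite -(eqn_pmul2r g0) mul1n muln_gcdl -bE -dE.
  have /coprimezP[[u v] /= uv] := cop.
  (* Since u b' + v d' = 1, the combination u (a, b) - v (c, -d) equals (j1, g), the second vector
     of the Hermite normal form; j1 is then reduced modulo h/g. *)
  pose j1 := u * a%:Z - v * c%:Z.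
  have en0 : (h %/ g)%N%:Z != 0 by lia.
  have jE : (`|(j1 %% (h %/ g)%N%:Z)%Z|%N)%:Z = j1 - (j1 %/ (h %/ g)%N%:Z)%Z * (h %/ g)%N%:Z.
    by rewrite gez0_abs ?modz_ge0 //; have := divz_eq j1 (h %/ g)%N%:Z; lia.
  exists g, (absz (j1 %% (h %/ g)%N%:Z)%Z); split.
  - by rewrite eE dvdn_mull.
  - by rewrite -ltz_nat gez0_abs ?modz_ge0 // ltz_pmod.
  set q := (j1 %/ _)%Z in jE.
  apply/andP; split; apply/inlatP => //.
  - exists (v + q * b'%:Z), b'%:Z; split; last by rewrite {1}bE PoszM.
    rewrite jE /j1 hg PoszD !PoszM.
    transitivity (a%:Z * (u * b'%:Z + v * d'%:Z)); first by rewrite uv mulr1.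
    by ring.
  - exists (u - q * d'%:Z), (- d'%:Z); split; last by rewrite {1}dE PoszM; ring.
    rewrite jE /j1 hg PoszD !PoszM.
    transitivity (c%:Z * (u * b'%:Z + v * d'%:Z)); first by rewrite uv mulr1.
    by ring.
have f00 := dvdn_gt0 h0 f0h.
have eqfj f j : (f %| h)%N -> (j < h %/ f)%N ->
    inlat h f j a b && inlat h f j c (- d%:Z) = (f == f0) && (j == j0).
  move=> fh je; apply/idP/idP => [/andP[A C]|/andP[/eqP -> /eqP ->]]; last first.
    by rewrite A0 C0.
  have fp := dvdn_gt0 h0 fh.
  (* Comparing determinants with h shows that the coordinate matrix is unimodular; this forces f1 =
     gcd(b, d). *)
  have basis f1 j1 : (f1 %| h)%N -> inlat h f1 j1 a b -> inlat h f1 j1 c (- d%:Z) ->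
      exists s t s' t' : int, [/\ t * s' - t' * s = 1,
        a%:Z = s * (h %/ f1)%N%:Z + t * j1%:Z, b%:Z = t * f1%:Z,
        c%:Z = s' * (h %/ f1)%N%:Z + t' * j1%:Z & - d%:Z = t' * f1%:Z].
    move=> f1h; have f10 := dvdn_gt0 h0 f1h.
    move=> /(inlatP _ _ _ _ f10)[s [t [aE bE]]] /(inlatP _ _ _ _ f10)[s' [t' [cE dE]]].
    exists s, t, s', t'; split => //.
    have hn0 : h%:Z != 0 by lia.
    apply: (mulIf hn0); rewrite mul1r.
    have hE1 : h%:Z = (h %/ f1)%N%:Z * f1%:Z by rewrite -PoszM divnK.
    have -> : (t * s' - t' * s) * h%:Z = a%:Z * - (- d%:Z) + b%:Z * c%:Z.
      by rewrite dE bE cE aE hE1; ring.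
    by rewrite opprK; lia.
  have gE f1 (s t s' t' : int) : t * s' - t' * s = 1 ->
      b%:Z = t * f1%:Z -> - d%:Z = t' * f1%:Z -> f1 = gcdn b d.
    move=> det bE dE.
    have bE' : b = (`|t| * f1)%N by have := congr1 absz bE; rewrite abszM.
    have dE' : d = (`|t'| * f1)%N by have := congr1 absz dE; rewrite abszN abszM.
    rewrite bE' dE' -muln_gcdl.
    suff -> : gcdn `|t| `|t'| = 1%N by rewrite mul1n.
    have : ((gcdn `|t| `|t'|)%:Z %| t * s' - t' * s)%Z.
      by rewrite rpredB // mulrC dvdz_mull // dvdzE ?dvdn_gcdl ?dvdn_gcdr.
    by rewrite det dvdzE /= dvdn1 => /eqP.
  have [s [t [s' [t' [det aE bE cE dE]]]]] := basis f j fh A C.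
  have [s0 [t0 [s0' [t0' [det0 aE0 bE0 cE0 dE0]]]]] := basis f0 j0 f0h A0 C0.
  have ff0 : f = f0 by rewrite (gE _ _ _ _ _ det bE dE) (gE _ _ _ _ _ det0 bE0 dE0).
  rewrite {}ff0 eqxx /= in fh je A C aE bE cE dE fp *.
  have fn0 : f0%:Z != 0 by lia.
  have tt0 : t = t0 by apply: (mulIf fn0); rewrite -bE.
  have tt0' : t' = t0' by apply: (mulIf fn0); rewrite -dE.
  subst t0 t0'.
  (* Both t (j - j0) and t' (j - j0) are multiples of h/f0; the relation t s' - t' s = 1 passes this
     on to j - j0. *)
  have jj : ((h %/ f0)%N%:Z %| j%:Z - j0%:Z)%Z.
    apply/dvdzP; exists (s' * (s0 - s) - s * (s0' - s')).
    transitivity ((j%:Z - j0%:Z) * (t * s' - t' * s)); first by rewrite det mulr1.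
    have E1 : t * (j%:Z - j0%:Z) = (s0 - s) * (h %/ f0)%N%:Z.
      by rewrite mulrBr mulrBl; move: aE aE0; lia.
    have E2 : t' * (j%:Z - j0%:Z) = (s0' - s') * (h %/ f0)%N%:Z.
      by rewrite mulrBr mulrBl; move: cE cE0; lia.
    transitivity (s' * (t * (j%:Z - j0%:Z)) - s * (t' * (j%:Z - j0%:Z))); first by ring.
    by rewrite E1 E2; ring.
  move: jj; rewrite -eqz_mod_dvd !modz_nat !modn_small //.
transitivity (\sum_(f <- divisors h) (f == f0))%N; last first.
  by rewrite sum_eq_seq ?divisors_uniq // -dvdn_divisors.
rewrite big_seq [RHS]big_seq; apply: eq_bigr => f; rewrite -dvdn_divisors // => fh.
transitivity (\sum_(0 <= j < h %/ f) (f == f0) * (j == j0))%N.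
  by apply: eq_big_nat => j /andP[_ je]; rewrite eqfj // mulnb.
rewrite -big_distrr /= sum_eq_nat /=; case: eqP => [->|//].
by rewrite j0e.
Qed.

(** The ranges follow a half-open quadrant: p starts at 1 and q at 0. *)
Definition boxcount (P : nat -> nat -> bool) (X Y : nat) : nat :=
  (\sum_(1 <= p < X.+1) \sum_(0 <= q < Y.+1) P p q)%N.

Lemma boxcount_gt0 (P : nat -> nat -> bool) X Y :
  reflect (exists p q, [/\ (0 < p <= X)%N, (q <= Y)%N & P p q]) (0 < boxcount P X Y)%N.
Proof.
apply: (iffP idP) => [|[p [q [/andP[p0 pX] qY Ppq]]]].
  rewrite lt0n sum_nat_seq_neq0 => /hasP[p].
  rewrite mem_index_iota ltnS => pX; rewrite /= sum_nat_seq_neq0 => /hasP[q].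
  by rewrite mem_index_iota ltnS /= eqb0 negbK => qY Ppq; exists p, q.
rewrite lt0n sum_nat_seq_neq0; apply/hasP; exists p; first by rewrite mem_index_iota p0.
rewrite /= sum_nat_seq_neq0; apply/hasP; exists q; first by rewrite mem_index_iota.
by rewrite /= Ppq.
Qed.

(** * Lattice points in a box *)

(** Every point of P in the box is a multiple of (p0, q0), by division with remainder. Any K >= x
    may serve as cutoff, since m p0 <= x forces m <= K. *)
Lemma boxcount_ray (P : nat -> nat -> bool) (X Y p0 q0 : nat) :
  (0 < p0)%N -> P p0 q0 ->
  (forall k p q, P p q -> P (k * p)%N (k * q)%N) ->
  (forall p q p' q', P p q -> P p' q' -> (p' <= p)%N -> (q' <= q)%N ->
     P (p - p')%N (q - q')%N) ->
  (forall p q, (0 < p <= X)%N -> (q <= Y)%N -> P p q ->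
     (p0 <= p)%N /\ (p * q0 = p0 * q)%N) ->
  forall K x y, (x <= X)%N -> (y <= Y)%N -> (x <= K)%N ->
  boxcount P x y = (\sum_(1 <= m < K.+1) (m * p0 <= x) && (m * q0 <= y))%N.
Proof.
move=> p00 P0 PZ PB det K x y xX yY xK.
transitivity (\sum_(1 <= p < x.+1) \sum_(0 <= q < y.+1) \sum_(1 <= m < K.+1)
    (p == m * p0) * (q == m * q0))%N.
  apply: eq_big_nat => p /andP[p1 px]; apply: eq_big_nat => q /andP[_ qy].
  have pbox : (0 < p <= X)%N by lia.
  have qbox : (q <= Y)%N by lia.
  have [Ppq|nP] := boolP (P p q); last first.
    rewrite big1_seq // => m /andP[_]; rewrite mem_index_iota => /andP[m1 _].
    case: eqP => [pE|//]; case: eqP => [qE|//].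
    by move: nP; rewrite pE qE PZ.
  have [p0p pq] := det _ _ pbox qbox Ppq.
  pose m := (p %/ p0)%N.
  have [pE qE] : (p = m * p0 /\ q = m * q0)%N.
    have pe : (p = m * p0 + p %% p0)%N := divn_eq p p0.
    have r0 := ltn_pmod p p00.
    set r := (p %% p0)%N in pe r0.
    have qq : (m * q0 <= q)%N by rewrite -(leq_pmul2l p00) -pq pe; nia.
    have := PB _ _ _ _ Ppq (PZ m _ _ P0) _ qq.
    have -> : (p - m * p0 = r)%N by lia.
    move=> /(_ ltac:(lia)) Pr.
    (* A nonzero remainder r would give a point of P in the box with first coordinate below p0. *)
    case: (posnP r) => r1; last first.
      have [] := det r (q - m * q0)%N _ _ Pr; lia.
    rewrite r1 addn0 in pe; split => //.
    by apply/eqP; rewrite -(eqn_pmul2l p00) -pq {1}pe; apply/eqP; ring.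
  transitivity (\sum_(1 <= k < K.+1) (k == m))%N.
    by rewrite sum_eq_nat; apply/esym/eqP; rewrite eqb1; nia.
  apply: eq_big_nat => k _.
  rewrite pE eqn_pmul2r // [k == m]eq_sym; case: (eqVneq m k) => [<-|//].
  by rewrite qE eqxx.
under eq_bigr => p _ do rewrite exchange_big_nat.
rewrite exchange_big_nat /=; apply: eq_big_nat => m /andP[m1 _].
under eq_bigr => p _ do rewrite -big_distrr /= sum_eq_nat.
rewrite -big_distrl /= sum_eq_nat mulnb !ltnS muln_gt0 m1 p00 //.
Qed.

(* Inside the box every point of P lies on one ray, where Möbius inversion
   detects the primitive point. *)
Lemma sum_mobius_boxcount (R : comPzRingType) (P : nat -> nat -> bool) (X Y K : nat) :
  (X <= K)%N ->
  (forall k p q, P p q -> P (k * p)%N (k * q)%N) ->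
  (forall p q p' q', P p q -> P p' q' -> (p' <= p)%N -> (q' <= q)%N ->
     P (p - p')%N (q - q')%N) ->
  (forall p q p' q', (0 < p <= X)%N -> (q <= Y)%N -> (0 < p' <= X)%N -> (q' <= Y)%N ->
     P p q -> P p' q' -> (p * q' = p' * q)%N) ->
  \sum_(1 <= k < K.+1) mobius R k * (boxcount P (X %/ k) (Y %/ k))%:R =
  (0 < boxcount P X Y)%N%:R.
Proof.
move=> XK PZ PB det; case: boxcount_gt0 => [[p [q [pX qY Ppq]]]|none]; last first.
  rewrite big1_seq // => k _.
  suff -> : boxcount P (X %/ k) (Y %/ k) = 0%N by rewrite mulr0.
  apply/eqP; rewrite -leqn0 leqNgt; apply/negP => /boxcount_gt0[p [q [/andP[p0 pX] qY Ppq]]].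
  apply: none; exists p, q; split => //.
    by rewrite p0 (leq_trans pX (leq_div _ _)).
  exact: leq_trans qY (leq_div _ _).
pose good n := (0 < n <= X)%N && [exists q : 'I_Y.+1, P n q].
have exg : exists n, good n.
  by exists p; rewrite /good pX; apply/existsP; exists (Ordinal (qY : (q < Y.+1)%N)).
(* The least positive first coordinate picks out the primitive point of the ray. *)
have [p0 /andP[p0X /existsP[q0 P0]] minp] := ex_minnP exg.
have q0Y : (q0 <= Y)%N by rewrite -ltnS.
have p00 : (0 < p0)%N by case/andP: p0X.
have ray p' q' : (0 < p' <= X)%N -> (q' <= Y)%N -> P p' q' -> (p0 <= p')%N /\ (p' * q0 = p0 * q')%N.
  move=> p'X q'Y P'; split; last exact: det.
  by apply: minp; rewrite /good p'X; apply/existsP; exists (Ordinal (q'Y : (q' < Y.+1)%N)).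
(* The m-th multiple of the primitive point lies in the box shrunk by k iff the (k m)-th lies in the
   full box; Möbius inversion over n = k m leaves [F 1]. *)
pose F n : R := ((n * p0 <= X) && (n * q0 <= Y))%N%:R.
transitivity (\sum_(1 <= k < K.+1) \sum_(1 <= n < K.+1)
    if (k %| n)%N then mobius R k * F n else 0).
  apply: eq_big_nat => k /andP[k0 kK].
  rewrite -big_mkcond sum_multiples // -mulr_sumr; congr (_ * _).
  rewrite (boxcount_ray p00 P0 PZ PB ray (K := (K %/ k)%N)) ?leq_div ?leq_div2r //.
  rewrite natr_sum; apply: eq_bigr => m _; rewrite /F.
  by rewrite !leq_divRL // -!mulnA ![(k * _)%N]mulnC -!mulnA.
rewrite exchange_big_nat /=.
transitivity (\sum_(1 <= n < K.+1) (n == 1%N)%:R * F n).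
  apply: eq_big_nat => n /andP[n0 nK].
  by rewrite -big_mkcond -mulr_suml sum_mobius // n0.
have K0 : (0 < K)%N by lia.
rewrite big_ltn // eqxx mul1r big_nat big1 => [|n /andP[n1 _]]; last first.
  by rewrite gtn_eqF // mul0r.
by rewrite addr0 /F !mul1n q0Y; case/andP: p0X => _ ->.
Qed.

Lemma sum_dvdn (d x : nat) : (0 < d)%N -> (\sum_(1 <= p < x.+1) (d %| p) = x %/ d)%N.
Proof.
move=> d0; elim: x => [|x IH]; first by rewrite big_geq // div0n.
by rewrite big_nat_recr //= IH divnS // addnC.
Qed.

(* The half-open quadrants {(p, q) : 0 < p, 0 <= q} and {(q, - p) : 0 < p, 0 <= q}
   together contain exactly one of v and - v for every nonzero v. *)
Definition inlat1 (h f j p q : nat) : bool := inlat h f j p%:Z q%:Z.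
Definition inlat4 (h f j p q : nat) : bool := inlat h f j q%:Z (- p%:Z).

(** The abstract family [M] allows use in both quadrants. The successor on the right accounts for q
    = 0. *)
Lemma sum_boxcount (h : nat) (M : nat -> nat -> nat -> nat -> bool) (x y : nat) :
  (forall p q, \sum_(f <- divisors h) \sum_(0 <= j < h %/ f) M f j p q =
     \sum_(d <- divisors h | (d %| p) && (d %| q)) d)%N ->
  (\sum_(f <- divisors h) \sum_(0 <= j < h %/ f) boxcount (M f j) x y =
   \sum_(d <- divisors h) d * (x %/ d) * (y %/ d).+1)%N.
Proof.
move=> HM; rewrite /boxcount.
transitivity (\sum_(1 <= p < x.+1) \sum_(0 <= q < y.+1)
   \sum_(f <- divisors h) \sum_(0 <= j < h %/ f) M f j p q)%N.
  transitivity (\sum_(f <- divisors h) \sum_(1 <= p < x.+1) \sum_(0 <= q < y.+1)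
     \sum_(0 <= j < h %/ f) M f j p q)%N.
    apply: eq_bigr => f _; rewrite exchange_big; apply: eq_bigr => p _.
    by rewrite exchange_big.
  rewrite exchange_big; apply: eq_bigr => p _.
  by rewrite exchange_big.
transitivity (\sum_(1 <= p < x.+1) \sum_(0 <= q < y.+1)
   \sum_(d <- divisors h) d * (d %| p) * (d %| q))%N.
  apply: eq_bigr => p _; apply: eq_bigr => q _; rewrite HM big_mkcond; apply: eq_bigr => d _.
  by case: (d %| p)%N; case: (d %| q)%N; rewrite ?muln1 ?muln0.
transitivity (\sum_(d <- divisors h) \sum_(1 <= p < x.+1) \sum_(0 <= q < y.+1)
    d * (d %| p) * (d %| q))%N.
  rewrite [RHS]exchange_big; apply: eq_bigr => p _.
  by rewrite [RHS]exchange_big.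
rewrite big_seq [RHS]big_seq; apply: eq_bigr => d dh.
(* [divisors 0] is [[:: 1]], so positivity holds for h = 0 as well. *)
have d0 : (0 < d)%N.
  by case: h dh {HM} => [|h]; rewrite ?inE; [move/eqP ->|rewrite -dvdn_divisors //; apply: dvdn_gt0].
under eq_bigr => p _ do rewrite -big_distrr.
rewrite /= -big_distrl -big_distrr /= sum_dvdn //.
by rewrite big_ltn // dvdn0 sum_dvdn.
Qed.

Lemma boxcount_eq1 (P : nat -> nat -> bool) X Y p0 q0 :
  (0 < p0 <= X)%N -> (q0 <= Y)%N -> P p0 q0 ->
  (forall p q, (0 < p <= X)%N -> (q <= Y)%N -> P p q -> p = p0 /\ q = q0) ->
  boxcount P X Y = 1%N.
Proof.
move=> p0X q0Y P0 uq.
transitivity (\sum_(1 <= p < X.+1) \sum_(0 <= q < Y.+1) (p == p0) * (q == q0))%N.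
  apply: eq_big_nat => p pX; apply: eq_big_nat => q qY; rewrite mulnb; congr (nat_of_bool _).
  apply/idP/andP => [Ppq|[/eqP -> /eqP ->] //].
  by have [-> ->] := uq p q pX qY Ppq.
under eq_bigr => p _ do rewrite -big_distrr /= sum_eq_nat.
by rewrite -big_distrl /= sum_eq_nat !ltnS p0X q0Y.
Qed.

(** * Lattice vectors in the two quadrants *)

Lemma sum_inlat1 h p q : (0 < h)%N ->
  (\sum_(f <- divisors h) \sum_(0 <= j < h %/ f) inlat1 h f j p q =
   \sum_(d <- divisors h | (d %| p) && (d %| q)) d)%N.
Proof. by move=> h0; rewrite /inlat1 sum_inlat. Qed.

Lemma sum_inlat4 h p q : (0 < h)%N ->
  (\sum_(f <- divisors h) \sum_(0 <= j < h %/ f) inlat4 h f j p q =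
   \sum_(d <- divisors h | (d %| p) && (d %| q)) d)%N.
Proof.
move=> h0; rewrite /inlat4 sum_inlat //; apply: eq_bigl => d.
by rewrite abszN andbC.
Qed.

Lemma inlat1Z h f j k p q : (0 < f)%N -> inlat1 h f j p q -> inlat1 h f j (k * p) (k * q).
Proof. by move=> f0; rewrite /inlat1 !PoszM; exact: inlatZ. Qed.

Lemma inlat4Z h f j k p q : (0 < f)%N -> inlat4 h f j p q -> inlat4 h f j (k * p) (k * q).
Proof. by move=> f0; rewrite /inlat4 !PoszM -mulrN; exact: inlatZ. Qed.

Lemma inlat1B h f j p q p' q' : (0 < f)%N -> inlat1 h f j p q -> inlat1 h f j p' q' ->
  (p' <= p)%N -> (q' <= q)%N -> inlat1 h f j (p - p') (q - q').
Proof. by move=> f0 m m' ? ?; rewrite /inlat1 -!subzn //; exact: inlatB. Qed.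

Lemma inlat4B h f j p q p' q' : (0 < f)%N -> inlat4 h f j p q -> inlat4 h f j p' q' ->
  (p' <= p)%N -> (q' <= q)%N -> inlat4 h f j (p - p') (q - q').
Proof.
move=> f0 m m' ? ?; rewrite /inlat4 -!subzn //.
have -> : - (p%:Z - p'%:Z) = - p%:Z - - p'%:Z by ring.
exact: inlatB.
Qed.

Lemma eq_of_dvd_sub (h u v : nat) : (u < h)%N -> (v < h)%N ->
  (h%:Z %| u%:Z - v%:Z)%Z -> u = v.
Proof. by move=> uh vh; rewrite -eqz_mod_dvd !modz_nat !modn_small // => /eqP[]. Qed.

(** Both p q' and p' q are at most X Y < h, and they are congruent modulo h. *)
Lemma inlat1_det h f j X Y p q p' q' : (0 < f)%N -> (f %| h)%N -> (X * Y < h)%N ->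
  (p <= X)%N -> (q <= Y)%N -> (p' <= X)%N -> (q' <= Y)%N ->
  inlat1 h f j p q -> inlat1 h f j p' q' -> (p * q' = p' * q)%N.
Proof.
move=> f0 fh XY pX qY p'X q'Y m m'.
apply: (@eq_of_dvd_sub h); try nia.
by rewrite !PoszM; exact: inlat_det m m'.
Qed.

Lemma inlat4_det h f j X Y p q p' q' : (0 < f)%N -> (f %| h)%N -> (X * Y < h)%N ->
  (p <= Y)%N -> (q <= X)%N -> (p' <= Y)%N -> (q' <= X)%N ->
  inlat4 h f j p q -> inlat4 h f j p' q' -> (p * q' = p' * q)%N.
Proof.
move=> f0 fh XY pX qY p'X q'Y m m'.
apply: (@eq_of_dvd_sub h); try nia.
have := inlat_det f0 fh m m'; rewrite !PoszM.
by have -> : q%:Z * - p'%:Z - q'%:Z * - p%:Z = p%:Z * q'%:Z - p'%:Z * q%:Z by ring.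
Qed.

(** Up to sign a d + b c is a determinant, so it is a multiple of h; it is positive and at most 2 X
    Y < 2 h. *)
Lemma inlat14_det h f j X Y a b c d : (0 < f)%N -> (f %| h)%N -> (X * Y < h)%N ->
  (0 < a <= X)%N -> (b <= Y)%N -> (c <= X)%N -> (0 < d <= Y)%N ->
  inlat1 h f j a b -> inlat4 h f j d c -> (a * d + b * c = h)%N.
Proof.
move=> f0 fh XY aX bY cX dY m m'.
have := inlat_det f0 fh m m'.
have -> : a%:Z * - d%:Z - c%:Z * b%:Z = - (a * d + b * c)%N%:Z.
  by rewrite PoszD !PoszM; ring.
rewrite dvdzE abszN => /dvdnP[k kE]; rewrite /= in kE.
have k2 : (k < 2)%N by nia.
by case: k kE k2 => [|[|k]] //; nia.
Qed.

(** The pigeonhole vector makes at least one count positive. If both are, each equals 1 and both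
    sides are 2; otherwise both sides are 1. *)
Lemma boxcount_inlat14 h f j X Y : (0 < h)%N -> (f %| h)%N ->
  (X * Y < h < X.+1 * Y.+1)%N ->
  (boxcount (inlat1 h f j) X Y * boxcount (inlat4 h f j) Y X + 1 =
   (0 < boxcount (inlat1 h f j) X Y) + (0 < boxcount (inlat4 h f j) Y X))%N.
Proof.
move=> h0 fh /andP[XY hXY]; have f0 := dvdn_gt0 h0 fh.
have [B1|B1] := posnP (boxcount (inlat1 h f j) X Y);
  have [B4|B4] := posnP (boxcount (inlat4 h f j) Y X); rewrite ?B1 ?B4 ?muln0 //=.
  exfalso.
  have [x [y [m xX yY nz]]] := inlat_pigeonhole j h0 fh hXY.
  suff : (0 < boxcount (inlat1 h f j) X Y)%N || (0 < boxcount (inlat4 h f j) Y X)%N by rewrite B1 B4.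
  have mN : inlat h f j (- x) (- y).
    by have := inlatZ (-1) f0 m; rewrite !mulN1r.
  have [[x0 y0]|[x0 y0]|[x0 y0]|[x0 y0]] : [\/ (0 < x) /\ (0 <= y), (x < 0) /\ (y <= 0),
     (0 <= x) /\ (y < 0) | (x <= 0) /\ (0 < y)].
    have [?|?|?] := ltrgtP x 0; have [?|?|?] := ltrgtP y 0; subst; rewrite ?eqxx ?orbT in nz;
    by [constructor 1; lia|constructor 2; lia|constructor 3; lia|constructor 4; lia|].
  - apply/orP; left; apply/boxcount_gt0; exists `|x|%N, `|y|%N; split; try lia.
    by rewrite /inlat1 !gez0_abs // ltW.
  - apply/orP; left; apply/boxcount_gt0; exists `|x|%N, `|y|%N; split; try lia.
    by rewrite /inlat1 !lez0_abs // ltW.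
  - apply/orP; right; apply/boxcount_gt0; exists `|y|%N, `|x|%N; split; try lia.
    by rewrite /inlat4 (gez0_abs x0) (lez0_abs (ltW y0)) opprK.
  - apply/orP; right; apply/boxcount_gt0; exists `|y|%N, `|x|%N; split; try lia.
    by rewrite /inlat4 (lez0_abs x0) (gez0_abs (ltW y0)).
have /boxcount_gt0[a [b [aX bY ab]]] := B1.
have /boxcount_gt0[d [c [dY cX dc]]] := B4.
have det a' b' c' d' := @inlat14_det h f j X Y a' b' c' d' f0 fh XY.
have -> : boxcount (inlat1 h f j) X Y = 1%N.
  apply: (boxcount_eq1 aX bY ab) => a' b' a'X b'Y ab'.
  have E := det _ _ _ _ aX bY cX dY ab dc; have E' := det _ _ _ _ a'X b'Y cX dY ab' dc.
  (* Being parallel to (a, b) and having the same determinant against (c, -d), the vector (a', b')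
     must equal (a, b). *)
  have Z : (a * b' = a' * b)%N by apply: (inlat1_det f0 fh XY _ bY _ b'Y ab ab'); lia.
  have aa : (a * h = a' * h)%N by rewrite -{1}E' -E; nia.
  have {}aa : a = a' by nia.
  by split => //; nia.
have -> : boxcount (inlat4 h f j) Y X = 1%N.
  apply: (boxcount_eq1 dY cX dc) => d' c' d'Y c'X dc'.
  have E := det _ _ _ _ aX bY cX dY ab dc; have E' := det _ _ _ _ aX bY c'X d'Y ab dc'.
  have Z : (d * c' = d' * c)%N by apply: (inlat4_det f0 fh XY _ cX _ c'X dc dc'); lia.
  have dd : (d * h = d' * h)%N by rewrite -{1}E' -E; nia.
  have {}dd : d = d' by nia.
  by split => //; nia.
by [].
Qed.

(** * Positive solutions counted through lattices *)

Definition poscount (h X Y : nat) : nat :=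
  (\sum_(1 <= a < X.+1) \sum_(0 <= b < Y.+1) \sum_(1 <= d < Y.+1) \sum_(0 <= c < X.+1)
     (a * d + b * c == h))%N.

(** A solution is a pair (a, b), (c, -d) with one vector in each quadrant. It lies in exactly one
    lattice, and conversely X Y < h makes any two such vectors of one lattice a solution. *)
Lemma poscountE h X Y : (0 < h)%N -> (X * Y < h)%N ->
  poscount h X Y = (\sum_(f <- divisors h) \sum_(0 <= j < h %/ f)
     boxcount (inlat1 h f j) X Y * boxcount (inlat4 h f j) Y X)%N.
Proof.
move=> h0 XY.
transitivity (\sum_(f <- divisors h) \sum_(0 <= j < h %/ f)
   \sum_(1 <= a < X.+1) \sum_(0 <= b < Y.+1) \sum_(1 <= d < Y.+1) \sum_(0 <= c < X.+1)
     (inlat1 h f j a b && inlat4 h f j d c))%N; last first.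
  apply: eq_bigr => f _; apply: eq_bigr => j _; rewrite /boxcount.
  rewrite big_distrl; apply: eq_bigr => a _; rewrite /= big_distrl; apply: eq_bigr => b _.
  rewrite /= big_distrr; apply: eq_bigr => d _; rewrite /= big_distrr; apply: eq_bigr => c _.
  by rewrite /= mulnb.
transitivity (\sum_(1 <= a < X.+1) \sum_(0 <= b < Y.+1) \sum_(1 <= d < Y.+1) \sum_(0 <= c < X.+1)
   \sum_(f <- divisors h) \sum_(0 <= j < h %/ f) (inlat1 h f j a b && inlat4 h f j d c))%N.
  apply: eq_big_nat => a aX; apply: eq_big_nat => b bY; apply: eq_big_nat => d dY.
  apply: eq_big_nat => c cX; case: eqP => [E|E]; first by rewrite sum_inlat_pair.
  rewrite big_seq big1 // => f; rewrite -dvdn_divisors // => fh.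
  rewrite big1 // => j _; apply/eqP; rewrite eqb0; apply/negP => /andP[m m'].
  by apply: E; apply: (inlat14_det (dvdn_gt0 h0 fh) fh XY aX bY cX dY m m').
(* The range of j depends on f; flattening both into one list permits the exchanges of summation. *)
pose L := [seq (f, j) | f <- divisors h, j <- index_iota 0 (h %/ f)].
have LE (F : nat -> nat -> nat) : (\sum_(f <- divisors h) \sum_(0 <= j < h %/ f) F f j =
    \sum_(l <- L) F l.1 l.2)%N by rewrite big_allpairs_dep.
rewrite [RHS]LE /=.
rewrite [RHS]exchange_big; apply: eq_bigr => a _.
rewrite [RHS]exchange_big; apply: eq_bigr => b _.
rewrite [RHS]exchange_big; apply: eq_bigr => d _.
rewrite [RHS]exchange_big; apply: eq_bigr => c _.
exact: LE.
Qed.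

(** Sum of [boxcount_inlat14] over all lattices, of which there are h/f for each f. *)
Lemma poscount_lattices h X Y : (0 < h)%N -> (X * Y < h < X.+1 * Y.+1)%N ->
  (poscount h X Y + \sum_(f <- divisors h) h %/ f =
   \sum_(f <- divisors h) \sum_(0 <= j < h %/ f) (0 < boxcount (inlat1 h f j) X Y) +
   \sum_(f <- divisors h) \sum_(0 <= j < h %/ f) (0 < boxcount (inlat4 h f j) Y X))%N.
Proof.
move=> h0 XYh; rewrite poscountE //; last by case/andP: XYh.
rewrite -!big_split /= big_seq [RHS]big_seq; apply: eq_bigr => f.
rewrite -dvdn_divisors // => fh.
transitivity (\sum_(0 <= j < h %/ f)
    (boxcount (inlat1 h f j) X Y * boxcount (inlat4 h f j) Y X + 1))%N.
  by rewrite big_split /= sum_nat_const_nat subn0 muln1.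
by rewrite -big_split /=; apply: eq_bigr => j _; exact: boxcount_inlat14.
Qed.

(** * Asymptotics of the positive solutions *)

(** Both inequalities are proved in nat after multiplication by m^2. *)
Lemma divn_mul_divn_approx (R : realType) (X Y m : nat) : (0 < m)%N ->
  `|((X %/ m) * (Y %/ m).+1)%N%:R - X%:R * Y%:R / m%:R ^+ 2| <= (X + Y)%:R / m%:R :> R.
Proof.
move=> m0; have mp : (0 : R) < m%:R by rewrite ltr0n.
set A := (X %/ m)%N; set B := (Y %/ m)%N.
have A1 : (m * A <= X)%N by rewrite mulnC leq_divM.
have A2 : (X <= m * A + m)%N by rewrite {1}(divn_eq X m) mulnC leq_add2l ltnW // ltn_pmod.
have B1 : (m * B <= Y)%N by rewrite mulnC leq_divM.
have B2 : (Y <= m * B + m)%N by rewrite {1}(divn_eq Y m) mulnC leq_add2l ltnW // ltn_pmod.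
have up : (m ^ 2 * (A * B.+1) <= X * Y + (X + Y) * m)%N.
  have : ((m * A) * (m * B + m) <= X * (Y + m))%N by apply: leq_mul; rewrite ?leq_add2r.
  by nia.
have lo : (X * Y <= m ^ 2 * (A * B.+1) + (X + Y) * m)%N.
  have : (X * Y <= (m * A + m) * Y)%N by apply: leq_mul.
  have : (m * A * Y <= m * A * (m * B + m))%N by apply: leq_mul.
  by nia.
rewrite -(ler_nat R) !natrD !natrM in up.
rewrite -(ler_nat R) !natrD !natrM in lo.
rewrite natrM natrD.
have -> : A%:R * B.+1%:R - X%:R * Y%:R / m%:R ^+ 2 =
   (m%:R ^+ 2 * (A%:R * B.+1%:R) - X%:R * Y%:R) / m%:R ^+ 2 :> R.
  by field; rewrite gt_eqF.
have -> : (X%:R + Y%:R) / m%:R = ((X%:R + Y%:R) * m%:R) / m%:R ^+ 2 :> R.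
  by field; rewrite gt_eqF.
rewrite normrM (@ger0_norm _ (_ ^-1)) ?invr_ge0 ?exprn_ge0 ?ler0n //.
rewrite ler_pM2r ?invr_gt0 ?exprn_gt0 // ler_norml; lra.
Qed.

(** The floor estimate is applied with m = k d. The weight d turns its error (X + Y)/(k d) into (X +
    Y)/k, which sums to the harmonic number times the number of divisors. *)
Lemma mobius_divisor_sum_approx (R : realType) (h X Y K : nat) : (0 < h)%N ->
  `|\sum_(1 <= k < K.+1) mobius R k *
      (\sum_(d <- divisors h) d * (X %/ k %/ d) * (Y %/ k %/ d).+1)%N%:R
    - X%:R * Y%:R * mobius_sum R K * \sum_(d <- divisors h) d%:R^-1|
  <= (X + Y)%:R * harm R K * (size (divisors h))%:R.
Proof.
move=> h0; set s := \sum_(d <- divisors h) d%:R^-1.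
rewrite /mobius_sum [X in X * s]mulr_sumr mulr_suml -sumrB.
rewrite /harm mulr_sumr mulr_suml; apply: (le_trans (ler_norm_sum _ _ _)).
rewrite big_nat [leRHS]big_nat; apply: ler_sum => k /andP[k0 _].
have kp : (0 : R) < k%:R by rewrite ltr0n.
have -> : X%:R * Y%:R * (mobius R k / k%:R ^+ 2) * s =
  mobius R k * (\sum_(d <- divisors h) X%:R * Y%:R / k%:R ^+ 2 / d%:R).
  by rewrite -mulr_sumr -/s; ring.
rewrite -mulrBr normrM natr_sum -sumrB.
rewrite -[leRHS]mul1r; apply: ler_pM => //; first exact: norm_mobius_le1.
apply: (le_trans (ler_norm_sum _ _ _)).
rewrite -(@sum1_size _ (divisors h)) natr_sum mulr_sumr.
rewrite big_seq [leRHS]big_seq; apply: ler_sum => d; rewrite -dvdn_divisors // => dh.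
have d0 := dvdn_gt0 h0 dh; have dp : (0 : R) < d%:R by rewrite ltr0n.
have m0 : (0 < k * d)%N by rewrite muln_gt0 k0.
have := @divn_mul_divn_approx R X Y _ m0.
rewrite -!divnMA -mulnA [(k * d)%:R]natrM mulr1; set Z := (_ * _.+1)%N => H.
rewrite natrM.
have -> : d%:R * Z%:R - X%:R * Y%:R / k%:R ^+ 2 / d%:R =
   d%:R * (Z%:R - X%:R * Y%:R / (k%:R * d%:R) ^+ 2) :> R.
  by field; rewrite !gt_eqF.
rewrite normrM (gtr0_norm dp).
have -> : (X + Y)%:R / k%:R = d%:R * ((X + Y)%:R / (k%:R * d%:R)) :> R.
  by field; rewrite !gt_eqF.
by rewrite ler_pM2l.
Qed.

(** Möbius inversion in each lattice replaces the indicator by box counts, whose sum over all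
    lattices is explicit. *)
Lemma meeting_lattices_approx (R : realType) (h X Y K : nat)
    (M : nat -> nat -> nat -> nat -> bool) : (0 < h)%N -> (X <= K)%N ->
  (forall p q, \sum_(f <- divisors h) \sum_(0 <= j < h %/ f) M f j p q =
     \sum_(d <- divisors h | (d %| p) && (d %| q)) d)%N ->
  (forall f j k p q, (f %| h)%N -> M f j p q -> M f j (k * p)%N (k * q)%N) ->
  (forall f j p q p' q', (f %| h)%N -> M f j p q -> M f j p' q' ->
     (p' <= p)%N -> (q' <= q)%N -> M f j (p - p')%N (q - q')%N) ->
  (forall f j p q p' q', (f %| h)%N -> (p <= X)%N -> (q <= Y)%N ->
     (p' <= X)%N -> (q' <= Y)%N -> M f j p q -> M f j p' q' -> (p * q' = p' * q)%N) ->
  `|(\sum_(f <- divisors h) \sum_(0 <= j < h %/ f) (0 < boxcount (M f j) X Y))%N%:R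
    - X%:R * Y%:R * mobius_sum R K * \sum_(d <- divisors h) d%:R^-1|
  <= (X + Y)%:R * harm R K * (size (divisors h))%:R.
Proof.
move=> h0 XK HM MZ MB Mdet.
suff -> : (\sum_(f <- divisors h) \sum_(0 <= j < h %/ f) (0 < boxcount (M f j) X Y))%N%:R =
   \sum_(1 <= k < K.+1) mobius R k *
      (\sum_(d <- divisors h) d * (X %/ k %/ d) * (Y %/ k %/ d).+1)%N%:R.
  exact: mobius_divisor_sum_approx.
transitivity (\sum_(f <- divisors h) \sum_(0 <= j < h %/ f) \sum_(1 <= k < K.+1)
   mobius R k * (boxcount (M f j) (X %/ k) (Y %/ k))%:R).
  rewrite natr_sum big_seq [RHS]big_seq; apply: eq_bigr => f.
  rewrite -dvdn_divisors // => fh; rewrite natr_sum; apply: eq_bigr => j _.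
  rewrite -[LHS](@sum_mobius_boxcount _ _ _ _ K) //.
  - by move=> k p q; exact: MZ.
  - by move=> p q p' q'; exact: MB.
  - by move=> p q p' q' /andP[_ pX] qY /andP[_ p'X] q'Y; exact: Mdet.
transitivity (\sum_(f <- divisors h) \sum_(1 <= k < K.+1) \sum_(0 <= j < h %/ f)
   mobius R k * (boxcount (M f j) (X %/ k) (Y %/ k))%:R).
  by apply: eq_bigr => f _; rewrite exchange_big.
rewrite exchange_big; apply: eq_bigr => k _ /=.
rewrite -(sum_boxcount _ _ HM) natr_sum mulr_sumr; apply: eq_bigr => f _.
by rewrite natr_sum mulr_sumr.
Qed.

Lemma poscount_approx (R : realType) (h X Y K : nat) : (0 < h)%N ->
  (X * Y < h < X.+1 * Y.+1)%N -> (X <= K)%N -> (Y <= K)%N ->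
  `|(poscount h X Y)%:R
    - (2 * (X%:R * Y%:R) * mobius_sum R K - h%:R) * \sum_(d <- divisors h) d%:R^-1|
  <= 2 * (X + Y)%:R * harm R K * (size (divisors h))%:R.
Proof.
move=> h0 XYh XK YK; have /andP[XY _] := XYh.
have gt0 f : (f %| h)%N -> (0 < f)%N := fun fh => dvdn_gt0 h0 fh.
have H1 := @meeting_lattices_approx R h X Y K (inlat1 h) h0 XK
  (fun p q => sum_inlat1 p q h0)
  (fun f j k p q fh => @inlat1Z h f j k p q (gt0 f fh))
  (fun f j p q p' q' fh => @inlat1B h f j p q p' q' (gt0 f fh))
  (fun f j p q p' q' fh => @inlat1_det h f j X Y p q p' q' (gt0 f fh) fh XY).
(* In the second quadrant X and Y exchange their roles. *)
have H4 := @meeting_lattices_approx R h Y X K (inlat4 h) h0 YK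
  (fun p q => sum_inlat4 p q h0)
  (fun f j k p q fh => @inlat4Z h f j k p q (gt0 f fh))
  (fun f j p q p' q' fh => @inlat4B h f j p q p' q' (gt0 f fh))
  (fun f j p q p' q' fh => @inlat4_det h f j X Y p q p' q' (gt0 f fh) fh XY).
have hE : (\sum_(f <- divisors h) h %/ f)%N%:R = h%:R * \sum_(d <- divisors h) d%:R^-1 :> R.
  rewrite natr_sum mulr_sumr big_seq [RHS]big_seq; apply: eq_bigr => f.
  rewrite -dvdn_divisors // => fh; rewrite natf_div //.
rewrite [(Y + X)%N]addnC [Y%:R * _]mulrC in H4.
have E := congr1 (fun n => n%:R : R) (poscount_lattices h0 XYh).
rewrite /= !natrD hE in E.
move: H1 H4 E; set s := \sum_(d <- divisors h) d%:R^-1.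
set S1 := (\sum_(f <- _) \sum_(0 <= j < _) (0 < boxcount (inlat1 h f j) _ _))%N.
set S4 := (\sum_(f <- _) \sum_(0 <= j < _) (0 < boxcount (inlat4 h f j) _ _))%N => H1 H4 E.
have -> : (poscount h X Y)%:R = S1%:R + S4%:R - h%:R * s by rewrite -E addrK.
have -> : S1%:R + S4%:R - h%:R * s - (2 * (X%:R * Y%:R) * mobius_sum R K - h%:R) * s =
  (S1%:R - X%:R * Y%:R * mobius_sum R K * s) + (S4%:R - X%:R * Y%:R * mobius_sum R K * s).
  ring.
apply: (le_trans (ler_normD _ _)).
apply: (le_trans (lerD H1 H4)).
rewrite le_eqVlt; apply/orP; left; apply/eqP; ring.
Qed.

(** Y is the largest integer with N Y < h, so N Y < h <= N (Y + 1). *)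
Lemma second_side_bounds (N h : nat) : (0 < N)%N -> (0 < h)%N -> (h <= 2 * N ^ 2)%N ->
  let Y := (h.-1 %/ N)%N in
  [/\ (N * Y < h < N.+1 * Y.+1)%N, (Y <= 2 * N)%N & (h <= N * Y + N)%N].
Proof.
move=> N0 h0 hN Y.
have h1 : (Y * N <= h.-1)%N := leq_divM _ _.
have h2 : (h.-1 < Y.+1 * N)%N := ltn_ceil _ N0.
split; nia.
Qed.

Lemma sum_inv_divisors_le (R : realType) h : (0 < h)%N ->
  0 <= \sum_(d <- divisors h) (d%:R^-1 : R) <= (size (divisors h))%:R.
Proof.
move=> h0; apply/andP; split; first by apply: sumr_ge0 => d _; rewrite invr_ge0 ler0n.
rewrite -(@sum1_size _ (divisors h)) natr_sum big_seq [leRHS]big_seq.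
apply: ler_sum => d; rewrite -dvdn_divisors // => dh; have d0 := dvdn_gt0 h0 dh.
by rewrite invf_le1 ?ler1n // ltr0n.
Qed.

Lemma poscount_main (R : realType) (N h : nat) :
  (0 < N)%N -> (0 < h)%N -> (h <= 2 * N ^ 2)%N ->
  `|(poscount h N (h.-1 %/ N))%:R
    - (2 / zeta (2 : R) - 1) * N%:R ^+ 2 * \sum_(d <- divisors h) d%:R^-1|
  <= 13 * (harm R (2 * N) * (size (divisors h))%:R * (N%:R + `|h%:R - N%:R ^+ 2|)).
Proof.
move=> N0 h0 hN; have [XYh Y2 hY] := second_side_bounds N0 h0 hN.
set Y := (h.-1 %/ N)%N in XYh Y2 hY *.
(* The cutoff 2 N bounds both sides N and Y of the box. *)
have NK : (N <= 2 * N)%N by lia.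
have := poscount_approx R h0 XYh NK Y2.
have K0 : (0 < 2 * N)%N by lia.
have := mobius_sum_approx R K0; have := harm_ge1 R K0; have z1 := zeta2_ge1 R.
have /andP[s0 st] := sum_inv_divisors_le R h0.
rewrite [(2 * N)%:R]natrM; set H := harm _ _; set c := mobius_sum _ _; set z := zeta 2 in z1 *.
set s := \sum_(d <- _) _ in s0 st *.
set t := (size _)%:R in st *.
move=> H1 Hc Hp.
have Np : (1 : R) <= N%:R by rewrite ler1n.
have Y2r : Y%:R <= 2 * N%:R :> R by rewrite -natrM ler_nat.
have Yge0 : (0 : R) <= Y%:R by rewrite ler0n.
have XYr : N%:R * Y%:R <= h%:R :> R by rewrite -natrM ler_nat ltnW //; case/andP: XYh.
have hYr : h%:R <= N%:R * Y%:R + N%:R :> R by rewrite -natrM -natrD ler_nat.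
rewrite natrD in Hp.
move: Hp; set P := (poscount _ _ _)%:R => Hp.
move: (N%:R) (Y%:R) (h%:R) P H1 Hc Hp Np Y2r Yge0 XYr hYr => n y k P H1 Hc Hp Np Y2r Yge0 XYr hYr.
clearbody H c z s t.
have zV0 : 0 < z^-1 by rewrite invr_gt0; lra.
have zV1 : z^-1 <= 1 by rewrite invf_le1; lra.
move: (z^-1) zV0 zV1 Hc => w w0 w1 Hc.
set E := `|k - n ^+ 2|.
have E0 : 0 <= E by rewrite normr_ge0.
have t0 : 0 <= t by lra.
(* Four errors: the lattice count, the truncation of 1/zeta(2), the replacement of N Y by N^2, and
   that of h by N^2. *)
have -> : P - (2 * w - 1) * n ^+ 2 * s =
  (P - (2 * (n * y) * c - k) * s) + (2 * (n * y)) * s * (c - w)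
    + 2 * w * s * (n * y - n ^+ 2) - s * (k - n ^+ 2) by ring.
have E1 : `|n * y - n ^+ 2| <= n + E.
  have : `|n * y - k| <= n by rewrite ler_norml; lra.
  have -> : n * y - n ^+ 2 = (n * y - k) + (k - n ^+ 2) by ring.
  by move=> ?; apply: (le_trans (ler_normD _ _)); rewrite lerD.
have ny : n * y <= 2 * n ^+ 2 by nra.
have A1 : `|P - (2 * (n * y) * c - k) * s| <= 6 * (H * t * n).
  apply: (le_trans Hp).
  have -> : 2 * (n + y) * H * t = 2 * (H * t) * (n + y) by ring.
  have Ht : 0 <= H * t by rewrite mulr_ge0 //; lra.
  by nra.
have A2 : `|2 * (n * y) * s * (c - w)| <= 4 * (H * t * n).
  rewrite normrM ger0_norm; last by rewrite !mulr_ge0 //; lra.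
  apply: (@le_trans _ _ (2 * (2 * n ^+ 2) * t * (2 * H / (2 * n)))).
    apply: ler_pM => //; first by rewrite !mulr_ge0 //; lra.
    apply: ler_pM => //; first by rewrite !mulr_ge0 //; lra.
    by rewrite ler_pM2l.
  rewrite le_eqVlt; apply/orP; left; apply/eqP; field; rewrite gt_eqF //; lra.
have A3 : `|2 * w * s * (n * y - n ^+ 2)| <= 2 * (H * t * (n + E)).
  rewrite normrM ger0_norm; last by rewrite !mulr_ge0 //; lra.
  rewrite [2 * (H * t * _)]mulrA; apply: ler_pM => //; first by rewrite !mulr_ge0 //; lra.
  rewrite -mulrA ler_pM2l //; apply: ler_pM; lra.
have A4 : `|s * (k - n ^+ 2)| <= H * t * E.
  rewrite normrM ger0_norm //; apply: ler_wpM2r => //.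
  by apply: (le_trans st); rewrite ler_peMl.
have HtE : 0 <= H * t * E by rewrite !mulr_ge0 //; lra.
apply: (le_trans (ler_normB _ _)); apply: (le_trans (lerD (ler_normD _ _) (lexx _))).
apply: (le_trans (lerD (lerD (ler_normD _ _) (lexx _)) (lexx _))).
have Htn : 0 <= H * t * n by rewrite !mulr_ge0 //; lra.
have D : H * t * (n + E) = H * t * n + H * t * E by ring.
(* The four bounds add up to 12 H t n + 3 H t E, within the constant 13. *)
rewrite D in A3 *; lra.
Qed.

(** * From all solutions to positive ones *)

Definition irange (K : nat) : seq int := [seq k%:Z - K%:Z | k <- iota 0 (2 * K).+1].

Lemma mem_irange K x : `|x| <= K%:Z -> x \in irange K.
Proof.
move=> xK; apply/mapP; exists (absz (x + K%:Z)); last by lia.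
by rewrite mem_iota; lia.
Qed.

Lemma size_irange K : size (irange K) = (2 * K).+1.
Proof. by rewrite size_map size_iota. Qed.

Definition shell (lo hi : nat) : seq int :=
  [seq k%:Z | k <- iota lo.+1 (hi - lo)] ++ [seq - k%:Z | k <- iota lo.+1 (hi - lo)].

Lemma mem_shell lo hi x : lo%:Z < `|x| -> `|x| <= hi%:Z -> x \in shell lo hi.
Proof.
move=> lx xh; rewrite mem_cat; have [x0|x0] := lerP 0 x.
  apply/orP; left; apply/mapP; exists (absz x); last by lia.
  by rewrite mem_iota; lia.
apply/orP; right; apply/mapP; exists (absz x); last by lia.
by rewrite mem_iota; lia.
Qed.

Lemma size_shell lo hi : size (shell lo hi) = (2 * (hi - lo))%N.
Proof. by rewrite size_cat !size_map size_iota; lia. Qed.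

(* Beyond B the list is empty, which makes its size uniformly bounded. *)
Definition factz (B : nat) (n : int) : seq (int * int) :=
  if (`|n| <= B)%N then
    [seq (x, (n %/ x)%Z) | x <- [seq d%:Z | d <- divisors `|n|] ++ [seq - d%:Z | d <- divisors `|n|]]
  else [::].

Lemma mem_factz B n x y : n != 0 -> (`|n| <= B)%N -> x * y = n -> (x, y) \in factz B n.
Proof.
move=> n0 nB xyn; rewrite /factz nB; have x0 : x != 0 by nia.
apply/mapP; exists x; last by rewrite -xyn mulrC mulzK.
have xd : `|x|%N \in divisors `|n|.
  by rewrite -dvdn_divisors; [rewrite -xyn abszM dvdn_mulr | lia].
rewrite mem_cat; have [xp|xn] := lerP 0 x.
  by apply/orP; left; apply/mapP; exists `|x|%N => //; lia.
by apply/orP; right; apply/mapP; exists `|x|%N => //; lia.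
Qed.

Lemma size_factz B D n : (forall m, (m <= B)%N -> (size (divisors m) <= D)%N) ->
  (size (factz B n) <= 2 * D)%N.
Proof.
move=> BD; rewrite /factz; case: ifP => [nB|//].
rewrite size_map size_cat !size_map; have := BD _ nB; lia.
Qed.

Lemma leq_size_allpairs_dep (S T U : Type) (f : S -> T -> U) (s : seq S) (t : S -> seq T) c :
  (forall x, size (t x) <= c)%N ->
  (size [seq f x y | x <- s, y <- t x] <= size s * c)%N.
Proof.
move=> tc; rewrite size_allpairs_dep; elim: s => //= x s IH.
by rewrite mulSn leq_add.
Qed.

(** Candidates for (a, d) or (b, c) in an exceptional solution: a zero entry, a nonzero product of
    absolute value at most n, or an entry in the gap between lo and hi. They are used with n = N^2 -
    h and the gap between N and Y. *)
Definition bad_pairs (B K n lo hi : nat) : seq (int * int) :=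
  [seq (0, x) | x <- irange K] ++ [seq (x, 0) | x <- irange K] ++
  [seq p | m <- iota 1 n, p <- factz B m%:Z ++ factz B (- m%:Z)] ++
  [seq (x, y) | x <- shell lo hi, y <- irange K] ++
  [seq (x, y) | x <- irange K, y <- shell lo hi].

Lemma size_bad_pairs B D K n lo hi :
  (forall m, (m <= B)%N -> (size (divisors m) <= D)%N) ->
  (size (bad_pairs B K n lo hi) <=
   2 * (2 * K).+1 + n * (4 * D) + 4 * ((hi - lo) * (2 * K).+1))%N.
Proof.
move=> BD; rewrite /bad_pairs 4!size_cat 2!(size_map _ (irange K)).
rewrite (size_allpairs _ (shell lo hi)) (size_allpairs _ (irange K)) size_irange size_shell.
have : (size [seq p | m <- iota 1 n, p <- factz B (m%:Z) ++ factz B (- m%:Z)] <= n * (4 * D))%N.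
  rewrite -[X in (X * _)%N](size_iota 1 n); apply: leq_size_allpairs_dep => m.
  by rewrite size_cat; have := size_factz m%:Z BD; have := size_factz (- m%:Z) BD; lia.
lia.
Qed.

(** One pair fixes the product of the other through the determinant, so the divisor bound leaves few
    completions. *)
Definition bad_quads (h B : nat) (L : seq (int * int)) : seq (int * int * int * int) :=
  [seq (p.1, q.1, q.2, p.2) | p <- L, q <- factz B (p.1 * p.2 - h%:Z)] ++
  [seq (q.1, p.1, p.2, q.2) | p <- L, q <- factz B (h%:Z + p.1 * p.2)].

Lemma size_bad_quads h B D L :
  (forall m, (m <= B)%N -> (size (divisors m) <= D)%N) ->
  (size (bad_quads h B L) <= 4 * D * size L)%N.
Proof.
move=> BD; rewrite size_cat.
apply: (@leq_trans (size L * (2 * D) + size L * (2 * D))); last by nia.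
by apply: leq_add; apply: leq_size_allpairs_dep => p; exact: size_factz.
Qed.

Lemma bad_quads_ad h B L (a b c d : int) : a * d - b * c = h%:Z -> b * c != 0 ->
  (`|(b * c)%R| <= B)%N -> (a, d) \in L -> (a, b, c, d) \in bad_quads h B L.
Proof.
move=> det bc0 bcB adL; rewrite mem_cat; apply/orP; left.
apply/allpairsPdep; exists (a, d), (b, c); split => //=.
have -> : a * d - h%:Z = b * c by lia.
exact: mem_factz.
Qed.

Lemma bad_quads_bc h B L (a b c d : int) : a * d - b * c = h%:Z -> a * d != 0 ->
  (`|(a * d)%R| <= B)%N -> (b, c) \in L -> (a, b, c, d) \in bad_quads h B L.
Proof.
move=> det ad0 adB bcL; rewrite mem_cat; apply/orP; right.
apply/allpairsPdep; exists (b, c), (a, d); split => //=.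
have -> : h%:Z + b * c = a * d by lia.
exact: mem_factz.
Qed.

(** The alternatives for b and d cover the solutions counted by [T] and those counted by [poscount].
    Outside the class a d > 0 > b c, either a product vanishes or both have one sign, and then the
    one smaller in absolute value is at most N^2 - h. Inside it, a b or d beyond min(N, Y) lies in
    the gap. *)
Lemma bad_or_good (h N Y : nat) (a b c d : int) : (0 < h)%N -> (Y <= 2 * N)%N ->
  a * d - b * c = h%:Z -> `|a| <= N%:Z -> `|c| <= N%:Z ->
  (`|b| <= N%:Z /\ `|d| <= N%:Z) \/
  [/\ `|b| <= Y%:Z, `|d| <= Y%:Z, 0 < a * d & b * c <= 0] ->
  (a, b, c, d) \in bad_quads h (4 * N ^ 2)
     (bad_pairs (4 * N ^ 2) (2 * N) (N ^ 2 - h) (minn N Y) (maxn N Y)) \/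
  [/\ 0 < a * d, b * c < 0, `|b| <= (minn N Y)%:Z & `|d| <= (minn N Y)%:Z].
Proof.
move=> h0 Y2 det aN cN bd.
have bM : `|b| <= (maxn N Y)%:Z by case: bd => [[]|[]]; lia.
have dM : `|d| <= (maxn N Y)%:Z by case: bd => [[]|[]]; lia.
set L := bad_pairs _ _ _ _ _.
have adB : (`|(a * d)%R| <= 4 * N ^ 2)%N.
  rewrite abszM; apply: (@leq_trans (N * maxn N Y)); first by apply: leq_mul; lia.
  by nia.
have bcB : (`|(b * c)%R| <= 4 * N ^ 2)%N.
  rewrite abszM mulnC; apply: (@leq_trans (N * maxn N Y)); first by apply: leq_mul; lia.
  by nia.
have inK (x : int) : `|x| <= (maxn N Y)%:Z -> x \in irange (2 * N).
  by move=> ?; apply: mem_irange; lia.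
have zl (x y : int) : x * y = 0 -> x \in irange (2 * N) -> y \in irange (2 * N) -> (x, y) \in L.
  move=> /eqP; rewrite mulf_eq0 => /orP[/eqP ->|/eqP ->] xi yi; rewrite /L /bad_pairs 4!mem_cat.
    by apply/orP; left; apply: map_f.
  by apply/orP; right; apply/orP; left; apply/mapP; exists x.
have ai : a \in irange (2 * N) by apply: inK; lia.
have bi : b \in irange (2 * N) by apply: inK.
have ci : c \in irange (2 * N) by apply: inK; lia.
have di : d \in irange (2 * N) by apply: inK.
have [bc0|bcn0] := eqVneq (b * c) 0.
  left; apply: bad_quads_bc => //; last exact: zl.
  by lia.
have [ad0|adn0] := eqVneq (a * d) 0.
  by left; apply: bad_quads_ad => //; exact: zl.
have pl (x y : int) : x * y != 0 -> (`|(x * y)%R| <= N ^ 2 - h)%N -> (x, y) \in L.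
  move=> xy0 xyN; rewrite /L /bad_pairs 4!mem_cat; do 2 (apply/orP; right).
  apply/orP; left; apply/allpairsPdep; exists `|(x * y)%R|%N, (x, y); split => //.
    by rewrite mem_iota; lia.
  rewrite mem_cat; have [xyp|xyn] := lerP 0 (x * y).
    by rewrite mem_factz //; lia.
  by apply/orP; right; rewrite mem_factz //; lia.
have N2 : (N ^ 2 = N * N)%N by rewrite mulnn.
(* If b c > 0 then b c = a d - h <= N^2 - h, which is impossible for h > N^2, where the truncated
   difference is 0. The case a d < 0 is analogous. *)
have [bcp|bcneg] := lerP 0 (b * c).
  left; apply: bad_quads_bc => //; apply: pl => //.
  case: bd => [[bN dN]|[]]; last by lia.
  have : (`|(a * d)%R| <= N * N)%N by rewrite abszM; apply: leq_mul; lia.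
  by lia.
have [adneg|adp] := lerP (a * d) 0.
  left; apply: bad_quads_ad => //; apply: pl => //.
  case: bd => [[bN dN]|[]]; last by lia.
  have : (`|(b * c)%R| <= N * N)%N by rewrite abszM; apply: leq_mul; lia.
  by lia.
have [bs|bs] := lerP `|b| (minn N Y)%:Z; last first.
  left; apply: bad_quads_bc => //; rewrite /L /bad_pairs 4!mem_cat; do 3 (apply/orP; right).
  by apply/orP; left; apply/allpairsP; exists (b, c); split => //=; exact: mem_shell.
have [ds|ds] := lerP `|d| (minn N Y)%:Z; last first.
  left; apply: bad_quads_ad => //; rewrite /L /bad_pairs 4!mem_cat; do 4 (apply/orP; right).
  by apply/allpairsP; exists (a, d); split => //=; exact: mem_shell.
by right.
Qed.

(** A list form of [poscount], to be compared with [T] by inclusion of duplicate-free lists. *)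
Definition pos_quads (h X Y : nat) : seq ((nat * nat) * (nat * nat)) :=
  [seq z <- [seq (x, y) | x <- [seq (a, b) | a <- index_iota 1 X.+1, b <- index_iota 0 Y.+1],
                          y <- [seq (d, c) | d <- index_iota 1 Y.+1, c <- index_iota 0 X.+1]]
   | z.1.1 * z.2.1 + z.1.2 * z.2.2 == h]%N.

Lemma size_pos_quads h X Y : size (pos_quads h X Y) = poscount h X Y.
Proof.
rewrite size_filter -sum1_count big_mkcond big_allpairs big_allpairs.
apply: eq_bigr => a _; apply: eq_bigr => b _; rewrite big_allpairs.
by apply: eq_bigr => d _; apply: eq_bigr => c _ /=; case: eqP.
Qed.

Lemma uniq_pos_quads h X Y : uniq (pos_quads h X Y).
Proof.
by rewrite filter_uniq // !allpairs_uniq ?iota_uniq // => -[? ?] [? ?] _ _ [-> ->].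
Qed.

Lemma mem_pos_quads h X Y a b c d : ((a, b), (d, c)) \in pos_quads h X Y =
  [&& 0 < a <= X, b <= Y, 0 < d <= Y, c <= X & a * d + b * c == h]%N.
Proof.
rewrite mem_filter; apply/andP/and5P => [[E]|[aX bY dY cX E]].
  move=> /allpairsPdep[x [y [/allpairsPdep[a' [b' [aX bY ->]]]]]].
  move=> /allpairsPdep[d' [c' [dY cX ->]]] [eqa eqb eqd eqc].
  move: aX bY dY cX E; rewrite -eqa -eqb -eqd -eqc !mem_index_iota !ltnS.
  by move=> aX /= bY dY cX E; split.
split => //; apply/allpairsPdep; exists (a, b), (d, c); split => //.
  by apply/allpairsPdep; exists a, b; rewrite !mem_index_iota !ltnS.
by apply/allpairsPdep; exists d, c; rewrite !mem_index_iota !ltnS.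
Qed.

(** [e] holds the common sign of a and d and the sign of b; the minus sign at c turns a d + b c = h
    into a d - b c = h. *)
Definition signed_quad (e : int * int) (z : (nat * nat) * (nat * nat)) :
    int * int * int * int :=
  (e.1 * z.1.1%:Z, e.2 * z.1.2%:Z, - (e.2 * z.2.2%:Z), e.1 * z.2.1%:Z).

(** Let G be the positive solutions with b, c > 0 that fit both boxes. Sign changes embed four
    copies of G among the solutions counted by [T], and the remaining ones are bad; likewise
    [poscount] exceeds the size of G by at most the number of bad quadruples. *)
Lemma T_poscount (N h : nat) : (0 < N)%N -> (0 < h)%N -> (h <= 2 * N ^ 2)%N ->
  let Y := (h.-1 %/ N)%N in
  let bad := bad_quads h (4 * N ^ 2)
     (bad_pairs (4 * N ^ 2) (2 * N) (N ^ 2 - h) (minn N Y) (maxn N Y)) in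
  (T h N <= 4 * poscount h N Y + size bad)%N /\
  (4 * poscount h N Y <= T h N + 4 * size bad)%N.
Proof.
move=> N0 h0 hN Y bad; have [_ Y2 _] := second_side_bounds N0 h0 hN.
rewrite -/Y in Y2.
pose PL := pos_quads h N Y.
pose G := [seq z <- PL | [&& 0 < z.1.2, 0 < z.2.2, z.1.2 <= N & z.2.1 <= N]%N].
pose sg : seq (int * int) := [:: (1, 1); (1, -1); (-1, 1); (-1, -1)].
pose G4 := [seq signed_quad e z | e <- sg, z <- G].
have uPL : uniq PL := uniq_pos_quads _ _ _.
have uG : uniq G by rewrite filter_uniq.
have GPL : (size G <= size PL)%N by rewrite size_filter count_size.
have memG a b c d : ((a, b), (d, c)) \in G ->
    [/\ (0 < a <= N)%N, (0 < b <= minn N Y)%N, (0 < c <= N)%N, (0 < d <= minn N Y)%N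
      & (a * d + b * c = h)%N].
  rewrite mem_filter mem_pos_quads /= => /andP[/and4P[? ? ? ?]] /and5P[? ? ? ? /eqP ?].
  by split => //; lia.
have Gmem a b c d : (0 < a <= N)%N -> (0 < b <= minn N Y)%N -> (0 < c <= N)%N ->
    (0 < d <= minn N Y)%N -> (a * d + b * c = h)%N -> ((a, b), (d, c)) \in G.
  move=> ? ? ? ? E; rewrite mem_filter mem_pos_quads /= E eqxx.
  by apply/andP; split; [apply/and4P|apply/and5P]; split => //; lia.
have uG4 : uniq G4.
  apply: allpairs_uniq => // -[e z] [e' z'].
  move=> /allpairsPdep[e1 [z1 [es zG [-> ->]]]] /allpairsPdep[e2 [z2 [es' zG' [-> ->]]]].
  case: z1 z2 zG zG' => [[a b] [d c]] [[a' b'] [d' c']] /memG[? ? ? ? _] /memG[? ? ? ? _].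
  rewrite /signed_quad /=; move: es es'; rewrite !inE.
  by do 2![case/or4P => /eqP ->] => /=; rewrite ?mul1r ?mulN1r => -[E1 E2 E3 E4];
    (congr (_, _) || exfalso); try lia; congr ((_, _), (_, _)); lia.
pose E := enum_fset (fset_set (det_box h N)).
have TE : T h N = size E by [].
have memE a b c d : ((a, b, c, d) \in E) =
    [&& a * d - b * c == h%:Z, `|a| <= N%:Z, `|b| <= N%:Z, `|c| <= N%:Z & `|d| <= N%:Z].
  rewrite -[LHS]/((a, b, c, d) \in fset_set (det_box h N)) in_fset_set; last exact: finite_det_box.
  apply/idP/and5P; first by rewrite inE => -[-> [-> -> -> ->]].
  by move=> [/eqP ? ? ? ? ?]; rewrite inE.
have sG4 : size G4 = (4 * size G)%N by rewrite size_allpairs.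
have G4E : (size G4 <= size E)%N.
  apply: uniq_leq_size => // _ /allpairsPdep[e [[[a b] [d c]] [es /memG[aN bN cN dN det] ->]]].
  rewrite /signed_quad memE /=.
  by move: es; rewrite !inE => /or4P[] /eqP -> /=; rewrite ?mul1r ?mulN1r;
    apply/and5P; split; lia.
have EG4 : (size E <= size (G4 ++ bad))%N.
  apply: uniq_leq_size; first exact: fset_uniq.
  move=> [[[a b] c] d]; rewrite memE => /and5P[/eqP det aN bN cN dN].
  rewrite mem_cat; apply/orP.
  have [|[adp bcn bs ds]] := bad_or_good h0 Y2 det aN cN (or_introl (conj bN dN)); first by right.
  left.
  have adE : (0 < a /\ 0 < d) \/ (a < 0 /\ d < 0) by nia.
  have bcE : (0 < b /\ c < 0) \/ (b < 0 /\ 0 < c) by nia.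
  have zG : ((`|a|, `|b|), (`|d|, `|c|))%N \in G.
    by apply: Gmem; try lia; rewrite -!abszM; lia.
  case: adE => -[? ?]; case: bcE => -[? ?]; apply/allpairsPdep.
  - exists (1, 1), ((`|a|, `|b|), (`|d|, `|c|))%N; split => //.
    by rewrite /signed_quad /= !mul1r; congr (_, _, _, _); lia.
  - exists (1, -1), ((`|a|, `|b|), (`|d|, `|c|))%N; split => //.
    by rewrite /signed_quad /= !mul1r !mulN1r; congr (_, _, _, _); lia.
  - exists (-1, 1), ((`|a|, `|b|), (`|d|, `|c|))%N; split => //.
    by rewrite /signed_quad /= !mul1r !mulN1r; congr (_, _, _, _); lia.
  - exists (-1, -1), ((`|a|, `|b|), (`|d|, `|c|))%N; split => //.
    by rewrite /signed_quad /= !mulN1r; congr (_, _, _, _); lia.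
have PLG : (size PL <= size G + size bad)%N.
  (* This sign choice yields (a, -b, c, d), to which [bad_or_good] applies with its second
     alternative. *)
  pose f := signed_quad (1, -1).
  rewrite -(size_map f PL) -(size_map f G) -size_cat; apply: uniq_leq_size.
    rewrite map_inj_uniq // => -[[a b] [d c]] [[a' b'] [d' c']].
    rewrite /f /signed_quad /= !mul1r !mulN1r => -[E1 E2 E3 E4].
    by congr ((_, _), (_, _)); lia.
  move=> _ /mapP[[[a b] [d c]] zP ->]; rewrite mem_cat; apply/orP.
  move: (zP); rewrite mem_pos_quads => /and5P[aN bY dY cN /eqP det].
  rewrite /f /signed_quad /= !mul1r !mulN1r opprK.
  have [] := @bad_or_good h N Y a%:Z (- b%:Z) c%:Z d%:Z h0 Y2; try lia.
  - by right; split; nia.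
  - by right.
  move=> [adp bcn bs ds]; left; apply/mapP; exists ((a, b), (d, c)).
    by apply: Gmem; try lia; nia.
  by rewrite /f /signed_quad /= !mul1r !mulN1r opprK.
rewrite size_cat in EG4; rewrite -size_pos_quads -/PL TE; lia.
Qed.

(** There are O(D (N + |h - N^2|)) bad pairs, each completed to at most 4 D bad quadruples. *)
Lemma T_poscount_approx (R : realType) (N h D : nat) :
  (0 < N)%N -> (0 < h)%N -> (h <= 2 * N ^ 2)%N ->
  (forall m, (m <= 4 * N ^ 2)%N -> (size (divisors m) <= D)%N) ->
  `|(T h N)%:R - 4 * (poscount h N (h.-1 %/ N))%:R| <=
   480 * (D%:R ^+ 2 * (N%:R + `|h%:R - N%:R ^+ 2|)) :> R.
Proof.
move=> N0 h0 hN HD; have [up lo] := T_poscount N0 h0 hN.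
have [XYh Y2 hY] := second_side_bounds N0 h0 hN.
set Y := (h.-1 %/ N)%N in XYh Y2 hY up lo *.
move: up lo; set L := bad_pairs _ _ _ _ _; set bad := bad_quads _ _ _ => up lo.
have D1 : (1 <= D)%N by have := HD 1%N; rewrite /=; apply; nia.
have sL := size_bad_pairs (2 * N) (N ^ 2 - h) (minn N Y) (maxn N Y) HD.
have sB := size_bad_quads h L HD; rewrite -/L in sL; rewrite -/bad in sB.
set u := (maxn N Y - minn N Y)%N in sL.
pose v := ((N ^ 2 - h) + (h - N ^ 2))%N.
(* N Y lies below h by at most N, so N |N - Y| is at most N + |h - N^2|. *)
have uv : (N * u <= N + v)%N.
  have /andP[XY _] := XYh.
  by rewrite /u /v -mulnn; have [NY|YN] := leqP N Y; rewrite mulnBr; lia.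
have vE : v%:R = `|h%:R - N%:R ^+ 2| :> R.
  rewrite /v -natrX; have [le|lt] := leqP (N ^ 2) h.
    rewrite ger0_norm ?subr_ge0 ?ler_nat // -natrB //; congr (_%:R); lia.
  rewrite ltr0_norm ?subr_lt0 ?ltr_nat // opprB -natrB ?(ltnW lt) //; congr (_%:R); lia.
(* As u <= N u <= N + v, the three terms are at most 10 N, 4 D v and 20 (N + v). The later 480 is 4
   * 4 * 30. *)
have sL' : (size L <= 30 * (D * (N + v)))%N.
  apply: (leq_trans sL).
  have wv : (N ^ 2 - h <= v)%N by rewrite /v leq_addr.
  have uN : (u <= N * u)%N by rewrite leq_pmull.
  have DN : (N <= D * N)%N by rewrite leq_pmull.
  have Dv : (v <= D * v)%N by rewrite leq_pmull.
  have Dw : ((N ^ 2 - h) * (4 * D) <= 4 * (D * v))%N.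
    by rewrite mulnCA leq_mul2l /= mulnC leq_mul2l wv orbT.
  have -> : (u * (2 * (2 * N)).+1 = 4 * (N * u) + u)%N by ring.
  by rewrite mulnDr; clear - uv uN DN Dv Dw N0; lia.
have sB' : (4 * size bad <= 480 * (D ^ 2 * (N + v)))%N.
  have := leq_mul (leqnn D) sL'.
  have -> : (D * (30 * (D * (N + v))) = 30 * (D ^ 2 * (N + v)))%N by ring.
  by rewrite -mulnA in sB; clear - sB; lia.
have upR : (T h N)%:R <= 4 * (poscount h N Y)%:R + (size bad)%:R :> R.
  by rewrite -natrM -natrD ler_nat.
have loR : 4 * (poscount h N Y)%:R <= (T h N)%:R + 4 * (size bad)%:R :> R.
  by rewrite -!natrM -natrD ler_nat.
have sBR : 4 * (size bad)%:R <= 480 * (D%:R ^+ 2 * (N%:R + v%:R)) :> R.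
  rewrite -natrX -(natrD R N v) -(natrM R (D ^ 2)) -(natrM R 4) -(natrM R 480).
  by rewrite ler_nat.
have : (0 : R) <= (size bad)%:R by rewrite ler0n.
rewrite -vE ler_norml; move: upR loR sBR.
move: (T h N)%:R (poscount h N Y)%:R (size bad)%:R (D%:R ^+ 2 * _) => t p s z *; lra.
Qed.

(** * Choice of exponents and assembly of the error terms *)

Theorem theorem1p2 (R : realType) (eps : R) (eps_gt0 : 0 < eps) :
  exists C : R, 0 < C /\
    forall N h : nat, (1 <= N)%N -> (1 <= h)%N -> (h <= 2 * N ^ 2)%N ->
      `| (T h N)%:R
         - (8 / zeta (2 : R) - 4) * N%:R ^+ 2 * (\sum_(d <- divisors h) d%:R^-1) |
      <= C * (N%:R `^ eps * (N%:R + `| h%:R - N%:R ^+ 2 |)).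
Proof.
(* The error carries two divisor bounds for integers up to 4 N^2 and one harmonic number: N^(2 dl)
   twice and N^dl once, together N^(5 dl). *)
pose dl := eps / 5; have dl0 : 0 < dl by rewrite /dl; lra.
have [C1 C11 tau] := size_divisors_le_powR dl0.
pose C2 := 1 + dl^-1; have C20 : 0 < C2.
  by rewrite /C2 addr_gt0 ?invr_gt0 //.
pose a := 4 `^ dl : R; pose b := 2 `^ dl : R.
have a0 : 0 < a by apply: powR_gt0; lra.
have b0 : 0 < b by apply: powR_gt0; lra.
have C10 : 0 < C1 by lra.
(* 532 = 480 + 4 * 13: the comparison with positive solutions, plus four times the error in their
   count. *)
exists (532 * (C1 ^+ 2 * a ^+ 2 * (C2 * b))); split.
  apply: mulr_gt0; first by rewrite ltr0n.
  by rewrite mulr_gt0 ?mulr_gt0 // exprn_gt0.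
move=> N h N0 h0 hN.
have hle : (h <= 4 * N ^ 2)%N by apply: (leq_trans hN); rewrite leq_mul2r orbT.
have N4 : (1 <= 4 * N ^ 2)%N by rewrite muln_gt0 expn_gt0 N0.
have K0 : (0 < 2 * N)%N by rewrite muln_gt0.
have Np : (1 : R) <= N%:R by rewrite ler1n.
pose w : R := N%:R `^ dl.
have w1 : 1 <= w by rewrite -[leLHS](powRr0 N%:R) ler_powR // ltW.
have wE : N%:R `^ eps = w ^+ 5.
  rewrite -powR_mulrn; last by lra.
  by rewrite -powRrM /dl; congr (_ `^ _); field.
have hH : harm R (2 * N) <= C2 * (b * w).
  by have := harm_le_powR dl0 K0; rewrite natrM powRM ?ler0n.
have qE : (4 * N ^ 2)%:R `^ dl = a * w ^+ 2.
  by rewrite natrM powRM ?ler0n // natrX !expr2 powRM ?ler0n //.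
pose D := Num.truncn (C1 * (a * w ^+ 2)).
have DB : D%:R <= C1 * (a * w ^+ 2).
  by rewrite truncn_le // !mulr_ge0 ?exprn_ge0 //; lra.
have HD m : (m <= 4 * N ^ 2)%N -> (size (divisors m) <= D)%N.
  move=> mN; rewrite truncn_ge_nat; last by rewrite !mulr_ge0 ?exprn_ge0 //; lra.
  (* [divisors 0] is [[:: 1]], so m = 0 only asks for 1 <= C1 (4 N^2)^dl. *)
  rewrite -qE; have [->|m0] := posnP m.
    have -> : size (divisors 0) = 1%N by [].
    apply: (@le_trans _ _ (C1 * 1 `^ dl)); first by rewrite powR1 mulr1.
    rewrite ler_pM2l // ge0_ler_powR ?nnegrE ?ler0n ?ler1n //; exact: ltW.
  apply: (le_trans (tau m m0)); rewrite ler_pM2l // ge0_ler_powR ?nnegrE ?ler0n ?ler_nat //.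
  exact: ltW.
have H1 := T_poscount_approx R N0 h0 hN HD.
have H2 := poscount_main R N0 h0 hN.
have tD : (size (divisors h))%:R <= D%:R :> R by rewrite ler_nat HD.
have D1 : (1 : R) <= D%:R.
  by rewrite ler1n; exact: (HD 1%N).
have Hge := harm_ge1 R K0.
move: H1 H2; set P := (poscount _ _ _)%:R; set s := \sum_(d <- _) _.
set E := N%:R + _; set t := (size _)%:R in tD *; set H := harm _ _ in hH Hge *.
move=> H1 H2.
have E0 : 0 <= E by rewrite /E; have := normr_ge0 (h%:R - N%:R ^+ 2 : R); lra.
have -> : (T h N)%:R - (8 / zeta (2 : R) - 4) * N%:R ^+ 2 * s =
  ((T h N)%:R - 4 * P) + 4 * (P - (2 / zeta (2 : R) - 1) * N%:R ^+ 2 * s) by ring.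
apply: (le_trans (ler_normD _ _)); rewrite [X in _ + X <= _]normrM (@ger0_norm _ 4) //.
(* Both errors are brought to the form D^2 H E, using H >= 1 and t <= D <= D^2. *)
apply: (@le_trans _ _ (532 * (D%:R ^+ 2 * H * E))).
  have A1 : D%:R ^+ 2 * E <= D%:R ^+ 2 * H * E.
    by rewrite ler_wpM2r // ler_peMr // exprn_ge0 //; lra.
  have A2 : H * t * E <= D%:R ^+ 2 * H * E.
    rewrite ler_wpM2r // mulrC ler_wpM2r //; first by lra.
    by apply: (le_trans tD); rewrite expr2 ler_peMr //; lra.
  lra.
suff : D%:R ^+ 2 * H * E <= C1 ^+ 2 * a ^+ 2 * (C2 * b) * (w ^+ 5 * E).
  rewrite wE; move: (D%:R ^+ 2 * H * E) (C1 ^+ 2 * _ * _) (w ^+ 5 * E) => x y z; lra.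
rewrite [leRHS]mulrA ler_wpM2r //.
have -> : C1 ^+ 2 * a ^+ 2 * (C2 * b) * w ^+ 5 = (C1 * (a * w ^+ 2)) ^+ 2 * (C2 * (b * w)) by ring.
apply: ler_pM => //; first by lra.
by rewrite lerXn2r ?nnegrE //; lra.
Qed.
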